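(* Let $n\ge 2$, $2\le l\le\lceil\frac{n+1}2\rceil$ and $k\in[2l-3,n-1]$. The assignments $s'_1\mapsto w_\circ^{[1,k]}$, $s'_2\mapsto w_\circ^{[l,n]}$ define an injective homomorphism of Hecke monoids $(W(B_2),\star)\to(W(B_n),\star)$, which is parabolic if and only if $k=n-1$, $l=2$. Moreover, up to the diagram automorphism of $(W(B_2),\star)$, this exhausts all injective connected homomorphisms $(W(B_2),\star)\to(W(B_n),\star)$.
   Context: For integers $a,b$ write $[a,b]=\{i\in\mathbb Z: a\le i\le b\}$. $B_n$ ($n\ge2$) denotes the Coxeter matrix over $[1,n]$ with $m_{i,i+1}=3$ for $i\le n-2$, $m_{n-1,n}=4$ and $m_{ij}=2$ for $|i-j|>1$. For a Coxeter matrix $M=(m_{ij})$ over a finite set $I$, the Hecke monoid $(W(M),\star)$ is generated by $s_i$, $i\in I$, subject to $s_i\star s_i=s_i$ and $s_i\star s_j\star\cdots=s_j\star s_i\star\cdots$ ($m_{ij}$ factors on each side) for $i\neq j$ with $m_{ij}<\infty$; its underlying set is identified with the Coxeter group $W(M)$ (a reduced word being sent to the $\star$-product of its letters). For $J\subset I$, $W_J(M)$ is the subgroup generated by $s_j$, $j\in J$; $\mathscr F(M)$ is the set of $J\subset I$ with $W_J(M)$ finite, and for such $J$, $w_\circ^J$ is the longest element of $W_J(M)$. For $J\subset K\in\mathscr F(M)$, $w_{J;K}=w_\circ^Jw_\circ^K$ (product in the Coxeter group). Generators of the domain are denoted $s'_i$. Homomorphisms of monoids preserve identity elements. For a homomorphism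 of Hecke monoids $\phi:(W(M'),\star)\to(W(M),\star)$, with $M'$ over $I'$ and $M$ over $I$, let $[\phi](i)$ be the support of $\phi(s'_i)$ (the set of indices occurring in a reduced expression) and $[\phi](J)=\bigcup_{j\in J}[\phi](j)$. $\phi$ is: connected if $[\phi](J)$ is a connected subset of $I$ for every connected $J\subset I'$, where a subset is connected if it induces a connected subgraph of the Coxeter graph (vertices $i,j$ joined iff $m_{ij}>2$); parabolic if for each $K'\in\mathscr F(M')$ and each $J'\subset K'$ there exists $J\subset[\phi](K')$ with $\phi(w_{J';K'})=w_{J;[\phi](K')}$. The diagram automorphism of $(W(B_2),\star)$ is the automorphism interchanging $s'_1$ and $s'_2$.
   Formalization: For n≥3 the exhaustion claim fails literally (s'_1↦s_{n-1}, s'_2↦s_n); it is proved for homomorphisms whose support is all of [1,n], and in general up to the standard inclusion of W(B_{n-p}) on the last n-p generators. *)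

(* Defs.v *)
From HB Require Import structures.
From mathcomp Require Import all_boot.
From mathcomp Require Import boolp classical_sets functions cardinality.

Set Implicit Arguments.
Unset Strict Implicit.
Unset Printing Implicit Defensive.

Local Open Scope quotient_scope.
Local Open Scope group_scope.

(* The congruence on the free monoid [seq I] generated by [R]. *)
Inductive pres_eq (I : Type) (R : seq I -> seq I -> Prop) :
    seq I -> seq I -> Prop :=
| PresStep u v a b of R a b : pres_eq R (u ++ a ++ v) (u ++ b ++ v)
| PresRefl u : pres_eq R u u
| PresSym u v of pres_eq R u v : pres_eq R v u
| PresTrans u v w of pres_eq R u v & pres_eq R v w : pres_eq R u w.

Lemma pres_eq_cat I (R : seq I -> seq I -> Prop) u u' v v' :
  pres_eq R u u' -> pres_eq R v v' -> pres_eq R (u ++ v) (u' ++ v').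
Proof.
move=> Hu Hv; apply: (@PresTrans _ _ _ (u' ++ v)).
  elim: Hu => {u u'} [u w a b Rab|u|u w _|u w x _ IH1 _] .
  - by rewrite -!catA; apply: PresStep.
  - exact: PresRefl.
  - exact: PresSym.
  - exact: PresTrans.
elim: Hv => {v v'} [v w a b Rab|v|v w _|v w x _ IH1 _] .
- by rewrite !(catA u'); apply: PresStep.
- exact: PresRefl.
- exact: PresSym.
- exact: PresTrans.
Qed.

Section Presented.
Variables (I : choiceType) (R : seq I -> seq I -> Prop).

Definition pres_rel (u v : seq I) : bool := `[< pres_eq R u v >].

Fact pres_rel_refl : reflexive pres_rel.
Proof. by move=> u; apply/asboolP; apply: PresRefl. Qed.

Fact pres_rel_sym : symmetric pres_rel.
Proof. by move=> u v; apply/asboolP/asboolP; apply: PresSym. Qed.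

Fact pres_rel_trans : transitive pres_rel.
Proof.
move=> v u w /asboolP uv /asboolP vw; apply/asboolP; exact: PresTrans uv vw.
Qed.

Canonical pres_equiv :=
  EquivRel pres_rel pres_rel_refl pres_rel_sym pres_rel_trans.

Definition presM := {eq_quot pres_equiv}.
HB.instance Definition _ := Choice.on presM.

(* The element of the presented monoid represented by a word. *)
Definition word (s : seq I) : presM := \pi_({eq_quot pres_equiv}) s.

Definition pres_repr (x : presM) : seq I := repr (x : {eq_quot pres_equiv}).

Lemma pres_reprK x : word (pres_repr x) = x.
Proof. exact: reprK. Qed.

Lemma word_eqP s t : word s = word t <-> pres_eq R s t.
Proof.
split=> [st|st].
  by apply/asboolP; have /eqquotP := st.
by apply/eqquotP/asboolP.
Qed.

Definition pres_one : presM := word [::].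
Definition pres_mul (x y : presM) : presM := word (pres_repr x ++ pres_repr y).

Lemma word_mul s t : pres_mul (word s) (word t) = word (s ++ t).
Proof.
by apply/word_eqP/pres_eq_cat; apply/word_eqP; rewrite pres_reprK.
Qed.

Fact pres_mulA : associative pres_mul.
Proof.
move=> x y z; rewrite -(pres_reprK x) -(pres_reprK y) -(pres_reprK z).
by rewrite !word_mul catA.
Qed.

Fact pres_mul1g : left_id pres_one pres_mul.
Proof. by move=> x; rewrite -(pres_reprK x) word_mul. Qed.

Fact pres_mulg1 : right_id pres_one pres_mul.
Proof. by move=> x; rewrite -(pres_reprK x) word_mul cats0. Qed.

HB.instance Definition _ :=
  isMonoid.Build presM pres_mulA pres_mul1g pres_mulg1.

Lemma wordM s t : word (s ++ t) = word s * word t.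
Proof. exact/esym/word_mul. Qed.

Lemma word1 : word [::] = 1.
Proof. by []. Qed.

End Presented.

(* Coxeter matrices; the entry 0 encodes m_ij = infinity. *)
Record coxeterMatrix (I : finType) := CoxeterMatrix {
  cox_m :> I -> I -> nat;
  cox_diag : forall i, cox_m i i = 1%N;
  cox_sym : forall i j, cox_m i j = cox_m j i;
  cox_offdiag : forall i j, i != j -> cox_m i j != 1%N
}.

(* The word i j i j ... with m letters. *)
Fixpoint alt (I : Type) (i j : I) (m : nat) : seq I :=
  if m is m'.+1 then i :: alt j i m' else [::].

(* The Coxeter relations (s_i s_j)^m_ij = 1; for i = j this is s_i^2 = 1, so
   the monoid with this presentation is the Coxeter group. *)
Inductive coxRel (I : finType) (M : coxeterMatrix I) : seq I -> seq I -> Prop :=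
| CoxRel i j of M i j != 0%N :
    coxRel M (flatten (nseq (M i j) [:: i; j])) [::].

Inductive heckeRel (I : finType) (M : coxeterMatrix I) :
    seq I -> seq I -> Prop :=
| HeckeIdem i : heckeRel M [:: i; i] [:: i]
| HeckeBraid i j of i != j & M i j != 0%N :
    heckeRel M (alt i j (M i j)) (alt j i (M i j)).

Definition Hecke (I : finType) (M : coxeterMatrix I) := presM (heckeRel M).
HB.instance Definition _ (I : finType) (M : coxeterMatrix I) :=
  Monoid.on (Hecke M).

Definition Cox (I : finType) (M : coxeterMatrix I) := presM (coxRel M).
HB.instance Definition _ (I : finType) (M : coxeterMatrix I) :=
  Monoid.on (Cox M).

Section CoxGroup.
Variables (I : finType) (M : coxeterMatrix I).

Definition cword (s : seq I) : Cox M := word (coxRel M) s.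

Let pres_eq_rev s t :
  pres_eq (coxRel M) s t -> pres_eq (coxRel M) (rev s) (rev t).
Proof.
elim=> {s t} [u v a b [i j Mij]|u|u v _|u v w _ IH1 _].
- rewrite rev_cat (rev_cat _ v) -catA (rev_cat u) cat0s.
  have -> : rev (flatten (nseq (M i j) [:: i; j])) =
      flatten (nseq (M j i) [:: j; i]).
    rewrite cox_sym; elim: (M j i) => // m IH.
    rewrite -addn1 nseqD flatten_cat rev_cat IH.
    by rewrite addnC nseqD flatten_cat.
  apply: (@PresStep _ _ (rev v) (rev u) _ [::]).
  by apply: CoxRel; rewrite cox_sym.
- exact: PresRefl.
- exact: PresSym.
- exact: PresTrans.
Qed.

Let rev_mul s : pres_eq (coxRel M) (rev s ++ s) [::].
Proof.
elim: s => [|i s IH]; first exact: PresRefl.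
rewrite rev_cons -cats1 -catA /=; apply: PresTrans IH.
have := @PresStep _ (coxRel M) (rev s) s [:: i; i] [::].
by apply; have := @CoxRel _ M i i; rewrite cox_diag; apply.
Qed.

Definition cox_inv (x : Cox M) : Cox M := cword (rev (pres_repr x)).

Fact cox_mulVg : left_inverse 1 cox_inv *%g.
Proof.
move=> x; rewrite -{2}(pres_reprK x) /cox_inv -[LHS]wordM -word1.
exact/word_eqP/rev_mul.
Qed.

Fact cox_mulgV : right_inverse 1 cox_inv *%g.
Proof.
move=> x; rewrite -{1}(pres_reprK x) /cox_inv -[LHS]wordM -word1.
by apply/word_eqP; have := rev_mul (rev (pres_repr x)); rewrite revK.
Qed.

HB.instance Definition _ := hasInv.Build (Cox M) cox_inv.
HB.instance Definition _ := Monoid_isGroup.Build (Cox M) cox_mulVg cox_mulgV.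

End CoxGroup.

Section CoxeterNotions.
Variables (I : finType) (M : coxeterMatrix I).

Definition cgen (i : I) : Cox M := cword M [:: i].
Definition hword (s : seq I) : Hecke M := word (heckeRel M) s.
Definition hgen (i : I) : Hecke M := hword [:: i].

Fact clen_ex (w : Cox M) :
  exists n, `[< exists2 s, cword M s = w & size s = n >].
Proof.
exists (size (pres_repr w)); apply/asboolP; exists (pres_repr w) => //.
exact: pres_reprK.
Qed.

Definition clen (w : Cox M) : nat := ex_minn (clen_ex w).

Definition reduced (s : seq I) : Prop := size s = clen (cword M s).

(* The identification of W(M) with the Hecke monoid as sets: send w to the
   star-product of the letters of a reduced word of w.  The default [::] is
   never used; the choice of the word does not matter, by Matsumoto. *)
Definition reduced_word (w : Cox M) : seq I :=
  xget [::] (fun s => reduced s /\ cword M s = w).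
Definition to_hecke (w : Cox M) : Hecke M := hword (reduced_word w).

Definition hsupp (x : Hecke M) : {set I} :=
  [set i | `[< exists s, [/\ reduced s, hword s = x & i \in s] >]].

Definition parab (J : {set I}) : set (Cox M) :=
  smallest (fun S => S 1 /\ forall x y, S x -> S y -> S (x / y))
           (fun w => exists2 j, j \in J & w = cgen j).

(* J belongs to F(M) *)
Definition finite_type (J : {set I}) : Prop := finite_set (parab J).

(* Meaningful for J of finite type only; the default 1 is used otherwise. *)
Definition longest (J : {set I}) : Cox M :=
  xget 1 (fun w => parab J w /\ forall v, parab J v -> (clen v <= clen w)%N).

Definition relative_longest (J K : {set I}) : Cox M := longest J * longest K.

Definition coxeter_adj (i j : I) : bool := (M i j == 0%N) || (2 < M i j)%N.

(* The empty set counts as connected; for [connected_hom] this is immaterial,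
   as the support of the empty set is empty. *)
Definition connected_subset (J : {set I}) : Prop :=
  {in J &, forall i j,
    connect [rel x y | [&& x \in J, y \in J & coxeter_adj x y]] i j}.

End CoxeterNotions.

Notation heckeHom M' M := (UMagmaMorphism.type (Hecke M') (Hecke M)).

Section HeckeHom.
Variables (I' I : finType) (M' : coxeterMatrix I') (M : coxeterMatrix I).
Variable phi : heckeHom M' M.

(* [phi](J) *)
Definition hom_supp (J : {set I'}) : {set I} :=
  \bigcup_(j in J) hsupp (phi (hgen M' j)).

Definition connected_hom : Prop :=
  forall J : {set I'}, connected_subset M' J -> connected_subset M (hom_supp J).

(* w_(J; K) is only defined for K in F(M), whence the finiteness condition
   on the support of K'. *)
Definition parabolic_hom : Prop :=
  forall K' J' : {set I'}, finite_type M' K' -> J' \subset K' ->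
    finite_type M (hom_supp K') /\
    exists2 J : {set I}, J \subset hom_supp K' &
      phi (to_hecke (relative_longest M' J' K')) =
      to_hecke (relative_longest M J (hom_supp K')).

End HeckeHom.

(* The Coxeter matrix B_n; the ordinal i : 'I_n stands for the index i.+1 of
   [1, n], so the bond of weight 4 joins the last two ordinals. *)
Definition B_m n (i j : 'I_n) : nat :=
  if i == j then 1%N
  else if (i.+1 == j) || (j.+1 == i) then
    (if (maxn i j).+1 == n then 4%N else 3%N)
  else 2%N.

Fact B_diag n (i : 'I_n) : B_m i i = 1%N.
Proof. by rewrite /B_m eqxx. Qed.

Fact B_sym n (i j : 'I_n) : B_m i j = B_m j i.
Proof. by rewrite /B_m eq_sym orbC maxnC. Qed.

Fact B_offdiag n (i j : 'I_n) : i != j -> B_m i j != 1%N.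
Proof. by rewrite /B_m => /negbTE->; do 2?case: ifP. Qed.

Definition B n : coxeterMatrix 'I_n :=
  CoxeterMatrix (@B_diag n) (@B_sym n) (@B_offdiag n).

(* The integer interval [a, b] as a subset of the index set [1, n]. *)
Definition itv n (a b : nat) : {set 'I_n} := [set i : 'I_n | a <= i.+1 <= b]%N.

(* w_o^[a, b] as an element of the Hecke monoid of B_n *)
Definition w0 n (a b : nat) : Hecke (B n) := to_hecke (longest (B n) (itv n a b)).

Definition s1' : Hecke (B 2) := hgen (B 2) (ord0 : 'I_2).
Definition s2' : Hecke (B 2) := hgen (B 2) (ord_max : 'I_2).

(* The diagram automorphism of the Hecke monoid of B_2. *)
Definition diag_aut (x : Hecke (B 2)) : Hecke (B 2) :=
  hword (B 2) (map (@rev_ord 2) (pres_repr x)).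

Lemma diag_aut_word s : diag_aut (hword (B 2) s) = hword (B 2) (map (@rev_ord 2) s).
Proof.
apply/word_eqP.
suff H u v : pres_eq (heckeRel (B 2)) u v ->
    pres_eq (heckeRel (B 2)) (map (@rev_ord 2) u) (map (@rev_ord 2) v).
  by apply/H/word_eqP; rewrite pres_reprK.
elim=> {u v} [u v a b Rab|u|u v _|u v w _ IH1 _]; last first.
- exact: PresTrans.
- exact: PresSym.
- exact: PresRefl.
rewrite !map_cat; apply: PresStep; case: Rab => [i|i j ij _].
  exact: HeckeIdem.
have map_alt x y m : map (@rev_ord 2) (alt x y m) = alt (rev_ord x) (rev_ord y) m.
  by elim: m x y => //= m IH x y; rewrite IH.
have E : B 2 i j = B 2 (rev_ord i) (rev_ord j).
  by case: i j {ij} => [[|[|//]] ?] [[|[|//]] ?].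
rewrite !map_alt E; apply: HeckeBraid; first by rewrite (inj_eq rev_ord_inj).
by rewrite -E; case: i j ij {E} => [[|[|//]] ?] [[|[|//]] ?].
Qed.

Fact diag_aut_morphism : monoid_morphism diag_aut.
Proof.
split=> [|x y]; first exact: (diag_aut_word [::]).
rewrite -(pres_reprK x) -(pres_reprK y) -wordM.
rewrite [LHS]diag_aut_word map_cat [LHS]wordM.
by congr (_ * _); rewrite -[LHS]diag_aut_word.
Qed.

HB.instance Definition _ :=
  isUMagmaMorphism.Build (Hecke (B 2)) (Hecke (B 2)) diag_aut diag_aut_morphism.

Lemma diag_autK : involutive diag_aut.
Proof.
move=> x; rewrite /diag_aut -/(diag_aut _) diag_aut_word -map_comp.
by rewrite (eq_map (@rev_ordK 2)) map_id [LHS]pres_reprK.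
Qed.

Lemma diag_aut_s1' : diag_aut s1' = s2'.
Proof. by rewrite diag_aut_word /=; congr (hword _ [:: _]); apply: val_inj. Qed.

Lemma diag_aut_s2' : diag_aut s2' = s1'.
Proof. by rewrite -diag_aut_s1' diag_autK. Qed.

(* Main.v *)
From HB Require Import structures.
From mathcomp Require Import all_boot all_order all_algebra.
From mathcomp Require Import zify.
From mathcomp Require Import boolp classical_sets cardinality.
Require Import Defs.
From mathcomp Require Import all_boot.

(* The Coxeter group and the Hecke monoid of B_n both act on integer sequences
   of length n: a generator exchanges, respectively sorts decreasingly, two
   neighbouring entries, and the last one changes, respectively makes positive,
   the sign of the last entry.  On the orbit of (-n, ..., -1) these actions are
   faithful by Matsumoto's theorem, the length being an inversion count, so that
   identities in the Hecke monoid become identities between sorted sequences.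

   An idempotent of the Hecke monoid is the absorbing element of the parabolic
   submonoid of its support.  Hence an injective connected homomorphism from B_2
   amounts to two intervals J, K with absorbing elements a, b such that
   abab = baba is absorbing for J and K while aba and bab are not.  Let a sort
   the first p + m of p + m + q consecutive entries and b the last m + q of them.
   If K ends at n, then abab = baba is absorbing iff p <= m.  If J and K both
   miss n, then q <= m makes aba absorbing, p <= m makes bab absorbing, and
   otherwise baba is not absorbing, so that this case does not occur. *)

Set Implicit Arguments.
Unset Strict Implicit.
Unset Printing Implicit Defensive.
Import Order.TTheory GRing.Theory Num.Theory.

(** * Actions on signed sequences *)

(** The bound 2l - 3 <= k is p <= m for p = l - 1 and m = k + 2 - l. It reflects that b does not
    reach the first p entries: a has to carry them, still negative, into the m entries common to
    both factors, and between two uses of a at most m of them can be made positive. Parabolicity is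
    decided by aba, the image of the relative longest element of {2} in {1, 2}: its value on (-n,
    ..., -1) has exactly p negative entries. The longest element of B_n acts by negation, so a
    relative longest element of J acts as w_o^J on (n, ..., 1). Comparing descents leaves a single
    possible index in J; hence w_o^J is trivial or one generator, and this forces p = 1 and q = 0. A
    final segment of the diagram is again of type B, so homomorphisms for smaller n yield injective
    connected ones whose support is not all of [1, n]. For this reason exhaustion is asserted for
    full support, and in general up to a common shift of both intervals. *)

Definition B_weight (n i j : nat) : nat :=
  if i == j then 1
  else if (i.+1 == j) || (j.+1 == i) then
    (if (maxn i j).+1 == n then 4 else 3)
  else 2.

(** The bond of weight 4 sits at the far end, so dropping the first entry of a sequence lowers all
    indices and keeps the type. Weights on bare naturals make this the induction step throughout. *)
Lemma B_weightS n i j : B_weight n.+1 i.+1 j.+1 = B_weight n i j.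
Proof. by rewrite /B_weight maxnSS; have E x y : (x.+1 == y.+1) = (x == y) by []; rewrite !E. Qed.

Lemma B_weightC n i j : B_weight n i j = B_weight n j i.
Proof. by rewrite /B_weight eq_sym orbC maxnC. Qed.

Lemma map_alt (T U : Type) (f : T -> U) i j m :
  map f (alt i j m) = alt (f i) (f j) m.
Proof. by elim: m i j => //= m IH i j; rewrite IH. Qed.

Section SignedSequences.
Local Open Scope ring_scope.

(* The generator i acts on the entries i and i + 1 by (f, g), except that the
   last generator acts on the last entry by k. *)
Fixpoint op (f g : int -> int -> int) (k : int -> int) (i : nat) (v : seq int) :
    seq int :=
  match i, v with
  | 0%N, [:: x] => [:: k x]
  | 0%N, x :: y :: v' => f x y :: g x y :: v'
  | i'.+1, x :: v' => x :: op f g k i' v'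
  | _, [::] => [::]
  end.

Lemma size_op f g k i v : size (op f g k i v) = size v.
Proof. by elim: v i => [|x v IH] [|i] //=; [case: v {IH}|rewrite IH]. Qed.

Definition opw f g k (s : seq nat) v := foldr (op f g k) v s.

Lemma size_opw f g k s v : size (opw f g k s v) = size v.
Proof. by elim: s => //= i s IH; rewrite size_op. Qed.

Lemma opw_consS f g k s x v : opw f g k (map S s) (x :: v) = x :: opw f g k s v.
Proof. by elim: s => //= i s ->. Qed.

(** Peeling common heads puts the smaller index at 0. The other index then either acts on disjoint
    entries, or is 1, and the relation concerns three entries, or two if the sequence ends there. *)
Lemma op_braid f g k n i j v :
    (forall x y z, opw f g k [:: 0; 1; 0]%N [:: x; y; z] =
                   opw f g k [:: 1; 0; 1]%N [:: x; y; z]) ->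
    (forall x y, opw f g k [:: 0; 1; 0; 1]%N [:: x; y] =
                 opw f g k [:: 1; 0; 1; 0]%N [:: x; y]) ->
    size v = n -> (i < n)%N -> (j < n)%N -> i != j ->
  opw f g k (alt i j (B_weight n i j)) v = opw f g k (alt j i (B_weight n i j)) v.
Proof.
move=> br3 br4.
wlog lt_ij : i j / (i < j)%N.
  move=> H sz ltin ltjn; rewrite neq_ltn => /orP[] lt_ij.
    by apply: H; rewrite ?neq_ltn ?lt_ij.
  by apply/esym; rewrite B_weightC; apply: H; rewrite ?neq_ltn ?lt_ij.
move=> <- _; elim: v i j lt_ij {n} => [|x v IH] [|i] [|j] //=; last first.
  move=> ltij ltj _; rewrite B_weightS -!(map_alt S) !opw_consS; congr cons.
  by apply: IH => //; lia.
case: j => [_ lt1 _|j _]; last first.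
  by case: v IH => [|y v].
case: v {IH} lt1 => [|y [|z v]] // _.
by have := br3 x y z; rewrite /B_weight /= => -[-> -> ->].
Qed.

Definition cact := op (fun _ y => y) (fun x _ => x) -%R.
Definition hact := op Num.max Num.min (fun x => `|x|).
Definition cactw (s : seq nat) v := foldr cact v s.
Definition hactw (s : seq nat) v := foldr hact v s.

Lemma size_cactw s v : size (cactw s v) = size v.
Proof. exact: size_opw. Qed.

Lemma size_hactw s v : size (hactw s v) = size v.
Proof. exact: size_opw. Qed.

Lemma cact_braid n i j v : size v = n -> (i < n)%N -> (j < n)%N -> i != j ->
  cactw (alt i j (B_weight n i j)) v = cactw (alt j i (B_weight n i j)) v.
Proof. by apply: op_braid. Qed.

Lemma hact_braid n i j v : size v = n -> (i < n)%N -> (j < n)%N -> i != j ->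
  hactw (alt i j (B_weight n i j)) v = hactw (alt j i (B_weight n i j)) v.
Proof.
by apply: op_braid => [x y z|x y] /=; [congr [:: _; _; _]|congr [:: _; _]]; lia.
Qed.

Lemma cactK i : involutive (cact i).
Proof.
move=> v; elim: v i => [|x v IH] [|i] //=; last by rewrite /cact /= -!/cact IH.
by case: v {IH} => [|y v] //; rewrite /cact /= opprK.
Qed.

Lemma hact_idem i v : hact i (hact i v) = hact i v.
Proof.
elim: v i => [|x v IH] [|i] //=; last by rewrite /hact /= -!/hact IH.
case: v {IH} => [|y v]; rewrite /hact /= ?normr_id //.
by congr [:: _, _ & _]; lia.
Qed.

(** * Ascents and the inversion count *)

Fixpoint asc (i : nat) (v : seq int) : bool :=
  match i, v with
  | 0%N, [:: x] => x < 0
  | 0%N, x :: y :: _ => x < y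
  | i'.+1, _ :: v' => asc i' v'
  | _, [::] => false
  end.

Lemma hactE i v : hact i v = if asc i v then cact i v else v.
Proof.
elim: v i => [|x v IH] [|i] //=; last first.
  by rewrite /hact /cact /= -/hact -/cact IH; case: ifP.
case: v {IH} => [|y v]; rewrite /hact /cact /=.
  by case: ifP => ?; congr [:: _]; lia.
by case: ifP => ?; congr [:: _, _ & _]; lia.
Qed.

(** Every letter, read from the right, meets an ascent; along such a word the two actions agree. *)
Fixpoint ascw (s : seq nat) (v : seq int) : bool :=
  if s is i :: s' then asc i (cactw s' v) && ascw s' v else true.

Lemma ascw_cat s t v : ascw (s ++ t) v = ascw s (cactw t v) && ascw t v.
Proof. by elim: s => //= i s IH; rewrite IH andbA /cactw foldr_cat. Qed.

Lemma cactw_consS s x v : cactw (map S s) (x :: v) = x :: cactw s v.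
Proof. exact: opw_consS. Qed.

Lemma ascw_consS s x v : ascw (map S s) (x :: v) = ascw s v.
Proof. by elim: s => //= i s IH; rewrite cactw_consS /= IH. Qed.

Lemma ascw_hactw s v : ascw s v -> hactw s v = cactw s v.
Proof. by elim: s => //= i s IH /andP[a /IH->]; rewrite hactE a. Qed.

(** The pairs that a leading entry x contributes to the type B length: later y with x > y, and later
    y with x + y > 0. Counting both makes the number invariant under permutations and sign changes
    of [v]. *)
Definition gcount (x : int) (v : seq int) : nat :=
  (count (fun y : int => y < x)%R v + count (fun y : int => - y < x)%R v)%N.

Fixpoint linv (v : seq int) : nat :=
  if v is x :: v' then ((0 < x)%R + gcount x v' + linv v')%N else 0%N.

Lemma gcount_cact x i v : gcount x (cact i v) = gcount x v.
Proof.
elim: v i => [|y v IH] [|i] //=.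
  by case: v {IH} => [|z v]; rewrite /gcount /cact /= ?opprK; lia.
by move: (IH i); rewrite /cact /= -/cact /gcount /=; lia.
Qed.

Lemma linv_asc i v : asc i v -> linv (cact i v) = (linv v).+1.
Proof.
elim: v i => [|x v IH] [|i] //=; last first.
  by rewrite /cact /= -/cact => /IH->; rewrite gcount_cact addnS.
case: v {IH} => [|y v]; rewrite /cact /=; first by rewrite /gcount /=; lia.
by rewrite /gcount /=; lia.
Qed.

Lemma linv_ascw s v : ascw s v -> linv (cactw s v) = (size s + linv v)%N.
Proof. by elim: s => //= i s IH /andP[/linv_asc-> /IH->]. Qed.

Lemma linv_le v : (linv v <= size v * (2 * size v))%N.
Proof.
elim: v => //= x v IH; rewrite /gcount.
set a := count _ v; set b := count _ v.
have : (a <= size v)%N by apply: count_size.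
have : (b <= size v)%N by apply: count_size.
by case: (0 < x) => /=; nia.
Qed.

Lemma linv_hact_ge i v : (linv v <= linv (hact i v))%N.
Proof. by rewrite hactE; case: ifP => // /linv_asc->. Qed.

Lemma linv_hact_eq i v : linv (hact i v) = linv v -> hact i v = v.
Proof. by rewrite hactE; case: ifP => // /linv_asc->; lia. Qed.

Lemma linv_hactw_ge s v : (linv v <= linv (hactw s v))%N.
Proof. by elim: s => //= i s IH; apply: leq_trans IH (linv_hact_ge _ _). Qed.

Lemma linv_hactw_eq s v : linv (hactw s v) = linv v -> hactw s v = v.
Proof.
elim: s => //= i s IH H.
have := linv_hact_ge i (hactw s v); have := linv_hactw_ge s v.
rewrite H => h1 h2; have E : linv (hactw s v) = linv v by lia.
by rewrite -[RHS]IH //; apply: linv_hact_eq; rewrite H E.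
Qed.

(** Sorting never lowers [linv], and a letter that keeps [linv] changes nothing; so a word that
    returns to [v] has not moved it at any letter. *)
Lemma hactw_fix s v : hactw s v = v -> forall i, i \in s -> hact i v = v.
Proof.
elim: s => //= i s IH H.
have E : hactw s v = v.
  apply: linv_hactw_eq; apply/eqP; rewrite eqn_leq linv_hactw_ge andbT.
  by rewrite -[X in (_ <= linv X)%N]H linv_hact_ge.
by move=> j; rewrite inE => /predU1P[->|/(IH E)//]; rewrite -[in LHS]E.
Qed.

Lemma linv_hactw_ascw s v : linv (hactw s v) = (size s + linv v)%N -> ascw s v.
Proof.
have le t : (linv (hactw t v) <= size t + linv v)%N.
  elim: t => //= i t IH; rewrite hactE; case: ifP => [/linv_asc->//|_].
  by rewrite (leq_trans IH).
elim: s => //= i s IH; have := le s; rewrite hactE; case: ifP => [a|_]; last lia.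
rewrite linv_asc // => _ [/IH as_]; rewrite as_ andbT.
by rewrite -(ascw_hactw as_).
Qed.

(** No ties: at every index either the sequence or its image under the generator has an ascent. *)
Definition generic (v : seq int) := uniq (0%N :: map absz v).

Lemma perm_absz_cact i v : perm_eq (map absz (cact i v)) (map absz v).
Proof.
elim: v i => [|x v IH] [|i] //; last by rewrite /= perm_cons.
case: v {IH} => [|y v]; first by rewrite /cact /= abszN.
by apply/permP => a; rewrite /cact /=; lia.
Qed.

Lemma perm_absz_hact i v : perm_eq (map absz (hact i v)) (map absz v).
Proof. by rewrite hactE; case: ifP => // _; exact: perm_absz_cact. Qed.

Lemma perm_absz_cactw s v : perm_eq (map absz (cactw s v)) (map absz v).
Proof. by elim: s => //= i s; apply: perm_trans; apply: perm_absz_cact. Qed.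

Lemma generic_cactw s v : generic (cactw s v) = generic v.
Proof. by apply: perm_uniq; rewrite perm_cons perm_absz_cactw. Qed.

Lemma generic_cons x v : generic (x :: v) -> generic v.
Proof. by rewrite /generic /= inE negb_or => /andP[/andP[_ ->] /andP[_ ->]]. Qed.

Lemma desc_asc i v : generic v -> (i < size v)%N -> ~~ asc i v -> asc i (cact i v).
Proof.
elim: v i => [|x v IH] [|i] //.
  case: v {IH} => [|y v]; rewrite /generic /cact /= !inE; first lia.
  by rewrite !negb_or; lia.
by move=> /generic_cons gv ltiv; apply: IH.
Qed.

Lemma asc_cact_linv i v : generic v -> (i < size v)%N ->
  asc i v = (linv (cact i v) == (linv v).+1).
Proof.
move=> gv ltiv; apply/idP/eqP => [/linv_asc//|H]; apply: contraPT H.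
move=> /(desc_asc gv ltiv)/linv_asc; rewrite cactK; lia.
Qed.

Lemma linv_cactw_le s v : generic v -> all (gtn (size v)) s ->
  (linv (cactw s v) <= size s + linv v)%N.
Proof.
move=> gv; elim: s => //= i s IH /andP[ltiv /IH]; set u := cactw s v.
have gu : generic u by rewrite generic_cactw.
case: (boolP (asc i u)) => [/linv_asc->|na]; first lia.
have ltiu : (i < size u)%N by rewrite size_cactw.
by have /linv_asc := desc_asc gu ltiu na; rewrite cactK; lia.
Qed.

Lemma ascw_linv s v : generic v -> all (gtn (size v)) s ->
  ascw s v = (linv (cactw s v) == size s + linv v)%N.
Proof.
move=> gv als; apply/idP/eqP => [/linv_ascw//|].
elim: s als => //= i s IH /andP[ltiv als]; have := linv_cactw_le gv als.
rewrite asc_cact_linv ?generic_cactw ?size_cactw //.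
set u := cactw s v in IH *; move=> le H.
case: (boolP (asc i u)) => [/linv_asc|na].
  by rewrite H => E; rewrite IH //; lia.
have ltiu : (i < size u)%N by rewrite size_cactw.
have gu : generic u by rewrite generic_cactw.
by have /linv_asc := desc_asc gu ltiu na; rewrite cactK; lia.
Qed.

(** The rank two input to Matsumoto's theorem: a sequence descending at i and j arises from some
    [v'] by the longest element of the subgroup generated by i and j, along both of its reduced
    words. The word [s] records that [v'] stays in the orbit of [v]. *)
Lemma double_descent n i j v : size v = n -> (i < n)%N -> (j < n)%N -> i != j ->
    asc i (cact i v) -> asc j (cact j v) ->
  exists2 v', [/\ ascw (alt i j (B_weight n i j)) v' & ascw (alt j i (B_weight n i j)) v']
  & (exists s, v' = cactw s v /\ all (gtn n) s) /\ cactw (alt i j (B_weight n i j)) v' = v.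
Proof.
suff main : forall i j v, size v = n -> (i < j < n)%N ->
    asc i (cact i v) -> asc j (cact j v) ->
  exists2 v', [/\ ascw (alt i j (B_weight n i j)) v' & ascw (alt j i (B_weight n i j)) v']
  & (exists s, v' = cactw s v /\ all (gtn n) s) /\ cactw (alt i j (B_weight n i j)) v' = v.
  move=> szv ltin ltjn; rewrite neq_ltn => /orP[] lt_ij ai aj.
    by apply: main => //; rewrite lt_ij.
  have [|v' [h1 h2] [[s [Es als]] E]] // := main j i v szv _ aj ai; first by rewrite lt_ij.
  exists v'; rewrite B_weightC //; split; first by exists s.
  rewrite -E B_weightC; apply: cact_braid; rewrite ?neq_ltn ?lt_ij ?orbT //.
  by rewrite Es size_cactw.
move=> {}i {}j {}v; elim: v i j n => [|x v IH] [|i] [|j] [|n] //= [szv] ltij.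
  move=> ai aj; case: j ltij aj => [_|j ltj]; last first.
    case: v {IH} szv ai => [|y v] //= szv ai aj.
    exists (y :: x :: cact j v); rewrite /B_weight /= /cact /= -/cact in ai aj *.
      by rewrite ai aj; case: v {szv aj} ai => [|? ?].
    split; last by rewrite /cactw /= cactK.
    by exists [:: 0; j.+2]%N; split; rewrite //= ltj; lia.
  case: v {IH} szv ai => [|y [|z v]] //= szv ai aj.
    (* The longest element of B_2 negates both entries. *)
    exists [:: - x; - y]; rewrite /B_weight -szv /= /cact /= ?oppr0 in ai aj *.
      by rewrite !opprK; split; lia.
    split; last by rewrite !opprK.
    by exists [:: 0; 1; 0; 1]%N; split; rewrite //= /cact /=.
  (* The longest element of A_2 reverses three entries. *)
  exists (z :: y :: x :: v); rewrite /B_weight -szv /= /cact /= in ai aj *.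
    by split; lia.
  by split => //; exists [:: 0; 1; 0]%N; split; rewrite //= /cact /=.
move=> ai aj; case: (IH i j n) => // v' [h1 h2] [[s [Es als]] E].
exists (x :: v'); rewrite B_weightS -!(map_alt S) ?ascw_consS //.
split; last by rewrite cactw_consS E.
exists (map S s); rewrite cactw_consS Es; split => //.
by rewrite all_map.
Qed.

Definition base n : seq int := [seq - (k%:Z) | k <- rev (iota 1 n)].

Lemma size_base n : size (base n) = n.
Proof. by rewrite size_map size_rev size_iota. Qed.

Lemma absz_base n : map absz (base n) = rev (iota 1 n).
Proof. by rewrite -map_comp -[RHS]map_id; apply: eq_map => k /=; rewrite abszN. Qed.

Lemma generic_base n : generic (base n).
Proof. by rewrite /generic absz_base /= rev_uniq iota_uniq mem_rev mem_iota. Qed.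

Lemma baseS n : base n.+1 = - (n.+1)%:Z :: base n.
Proof.
have E : iota 1 n.+1 = rcons (iota 1 n) n.+1.
  by rewrite -(addn1 n) iotaD cats1 add1n addn1.
by rewrite /base E rev_rcons.
Qed.

Lemma linv_base n : linv (base n) = 0%N.
Proof.
elim: n => // n IH; rewrite baseS /= IH /gcount addn0.
have -> : count (fun y => y < - (n.+1)%:Z) (base n) = 0%N.
  apply/eqP; rewrite -leqn0 leqNgt -has_count; apply/hasPn => y /mapP[k].
  by rewrite mem_rev mem_iota; lia.
have -> // : count (fun y => - y < - (n.+1)%:Z) (base n) = 0%N.
apply/eqP; rewrite -leqn0 leqNgt -has_count; apply/hasPn => y /mapP[k].
by rewrite mem_rev mem_iota; lia.
Qed.

Lemma all_asc_neg v : (forall i, (i < size v)%N -> asc i v) -> 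
  sorted <%R v /\ all (fun x => x < 0) v.
Proof.
elim: v => // x v IH H; have [|sv nv] := IH; first by move=> i; apply: (H i.+1).
move: (H 0%N isT) sv nv; case: v {IH H} => [|y v] /=; first by move=> ->.
by move=> xy -> /andP[y0 ->]; rewrite xy y0 (lt_trans xy y0).
Qed.

Lemma base_neg n : all (fun x => x < 0) (base n).
Proof. by apply/allP => x /mapP[k]; rewrite mem_rev mem_iota => ? ->; lia. Qed.

Lemma base_sorted n : sorted <%R (base n).
Proof.
elim: n => // n IH; rewrite baseS /= path_min_sorted //.
by apply/allP => x /mapP[k]; rewrite mem_rev mem_iota => ? ->; lia.
Qed.

Lemma all_asc_base v n : perm_eq (map absz v) (iota 1 n) ->
  (forall i, (i < size v)%N -> asc i v) -> v = base n.
Proof.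
move=> pv /all_asc_neg[sv nv]; apply: (sorted_eq lt_trans) sv (base_sorted n) _.
  by move=> x y /andP[]; lia.
have E w : all (fun x => x < 0) w -> w = [seq - (k%:Z) | k <- map absz w].
  move=> nw; rewrite -map_comp -[LHS]map_id; apply/eq_in_map => x.
  by move=> /(allP nw) /=; lia.
by rewrite (E v) // (E (base n)) ?base_neg // absz_base perm_map // perm_sym perm_rev perm_sym.
Qed.

(** Undo descents, each lowering [linv]; without descents the sequence is negative and increasing,
    hence [base n]. *)
Lemma ascw_exists v n : perm_eq (map absz v) (iota 1 n) ->
  exists s, [/\ all (gtn n) s, ascw s (base n) & cactw s (base n) = v].
Proof.
have [k] := ubnP (linv v); elim: k v => // k IH v lek pv.
have szv : size v = n by rewrite -(size_map absz) (perm_size pv) size_iota.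
have gv : generic v.
  rewrite /generic (@perm_uniq _ _ (0 :: iota 1 n)%N) ?perm_cons //=.
  by rewrite iota_uniq mem_iota.
case: (boolP [forall i : 'I_n, asc i v]) => [/forallP aall|].
  exists [::]; split=> //=; apply/esym/all_asc_base => // i; rewrite szv => lti.
  exact: (aall (Ordinal lti)).
rewrite negb_forall => /existsP[i na]; have lti := ltn_ord i.
have ltiv : (i < size v)%N by rewrite szv.
have ai := desc_asc gv ltiv na.
have [||s [als as_ Es]] := IH (cact i v).
- by have := linv_asc ai; rewrite cactK; lia.
- exact: perm_trans (perm_absz_cact _ _) pv.
by exists (nat_of_ord i :: s); rewrite /= lti als as_ Es ai cactK.
Qed.

End SignedSequences.

(** * Faithfulness, and absorbing elements *)

(** Braid moves hold in the Coxeter group and in the Hecke monoid alike, and so carry statements on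
    reduced words from one to the other. *)
Inductive braidRel (I : finType) (M : coxeterMatrix I) :
    seq I -> seq I -> Prop :=
| BraidRel i j of i != j & M i j != 0 :
    braidRel M (alt i j (M i j)) (alt j i (M i j)).

Lemma pres_eq_rel I (R : seq I -> seq I -> Prop) a b : R a b -> pres_eq R a b.
Proof. by move=> /(@PresStep _ _ [::] [::]); rewrite !cats0. Qed.

Lemma pres_eq_sub I (R R' : seq I -> seq I -> Prop) u v :
  (forall a b, R a b -> pres_eq R' a b) -> pres_eq R u v -> pres_eq R' u v.
Proof.
move=> RR'; elim=> {u v} [u v a b Rab|u|u v _|u v w _ IH1 _].
- by apply: pres_eq_cat (PresRefl _ _) (pres_eq_cat (RR' _ _ Rab) (PresRefl _ _)).
- exact: PresRefl.
- exact: PresSym.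
- exact: PresTrans.
Qed.

Lemma pres_eq_mem (I : eqType) (R : seq I -> seq I -> Prop) u v :
  (forall a b, R a b -> a =i b) -> pres_eq R u v -> u =i v.
Proof.
move=> RE; elim=> {u v} [u v a b Rab|u|u v _ IH|u v w _ IH1 _ IH2] x //.
- by rewrite !mem_cat (RE _ _ Rab).
- by rewrite IH1 IH2.
Qed.

Lemma mem_alt (I : eqType) (i j : I) m : 1 < m -> alt i j m =i [:: i; j].
Proof.
case: m => [|[|m]] // _ x; rewrite !inE; have [//|/=] := eqVneq x i.
have [//|/=] := eqVneq x j => xj xi; elim: m i j xi xj => //= m IH i j xi xj.
by rewrite inE (negbTE xi) IH.
Qed.

Lemma pres_eq_rev I (R : seq I -> seq I -> Prop) u v :
  (forall a b, R a b -> pres_eq R (rev a) (rev b)) ->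
  pres_eq R u v -> pres_eq R (rev u) (rev v).
Proof.
move=> Rr; elim=> {u v} [u v a b Rab|u|u v _|u v w _ IH1 _].
- rewrite !rev_cat -!catA.
  by apply: pres_eq_cat (PresRefl _ _) (pres_eq_cat (Rr _ _ Rab) (PresRefl _ _)).
- exact: PresRefl.
- exact: PresSym.
- exact: PresTrans.
Qed.

Lemma rev_alt I (i j : I) m :
  rev (alt i j m) = if odd m then alt i j m else alt j i m.
Proof.
have rc k (x y : I) : alt x y k.+1 = rcons (alt x y k) (if odd k then y else x).
  elim: k x y => // k IH x y.
  by rewrite -[LHS]/(x :: alt y x k.+1) IH /=; case: (odd k).
elim: m i j => // m IH i j; rewrite [in LHS]/= rev_cons IH !rc /=.
by case: (odd m).
Qed.

Lemma hecke_rev (I : finType) (M : coxeterMatrix I) s t :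
  hword M s = hword M t -> hword M (rev s) = hword M (rev t).
Proof.
move=> /word_eqP st; apply/word_eqP; apply: pres_eq_rev st => a b [i|i j ij Mij].
  exact/pres_eq_rel/HeckeIdem.
have H : pres_eq (heckeRel M) (alt i j (M i j)) (alt j i (M i j)).
  exact/pres_eq_rel/HeckeBraid.
by rewrite !rev_alt; case: ifP => // _; apply: PresSym.
Qed.

Section TypeB.
Variable n : nat.
Local Open Scope group_scope.
Local Notation nw := (map (@nat_of_ord n)).
Local Notation hw := (hword (B n)).
Local Notation cw := (cword (B n)).

Lemma cword_cons i s : cw (i :: s) = cgen (B n) i * cw s.
Proof. exact: (wordM _ [:: i]). Qed.

Lemma hword_cons i s : hw (i :: s) = hgen (B n) i * hw s.
Proof. exact: (wordM _ [:: i]). Qed.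

Lemma B_weightE (i j : 'I_n) : B n i j = B_weight n i j.
Proof. by []. Qed.

Lemma B_weight_neq (i j : 'I_n) : i != j ->
  [\/ B_weight n i j = 2, B_weight n i j = 3 | B_weight n i j = 4]%N.
Proof.
rewrite /B_weight => /negbTE; rewrite -val_eqE /= => ->.
by case: ifP => _; [case: ifP => _; [apply: Or33|apply: Or32]|apply: Or31].
Qed.

Lemma nw_lt s : all (gtn n) (nw s).
Proof. by apply/allP => _ /mapP[i _ ->] /=. Qed.

Lemma nw_lift s : all (gtn n) s -> exists t, nw t = s.
Proof.
elim: s => [|i s IH] /=; first by exists [::].
by case/andP=> lti /IH[t <-]; exists (Ordinal lti :: t).
Qed.

Lemma braid_hecke s t :
  pres_eq (braidRel (B n)) s t -> pres_eq (heckeRel (B n)) s t.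
Proof.
by apply: pres_eq_sub => _ _ [i j ij Mij]; apply/pres_eq_rel/HeckeBraid.
Qed.

Lemma cword_rev s : cw s * cw (rev s) = 1.
Proof.
elim: s => [|i s IH]; first by rewrite mul1g.
rewrite rev_cons -cats1 -cat1s /cword !wordM -!mulgA (mulgA (word _ s)).
rewrite -/(cw s) -/(cw (rev s)) IH mul1g -[LHS]wordM; apply/word_eqP/pres_eq_rel.
by have := @CoxRel _ (B n) i i; rewrite cox_diag; apply.
Qed.

Lemma flatten_alt m (i j : 'I_n) : [\/ m = 2, m = 3 | m = 4]%N ->
  flatten (nseq m [:: i; j]) = alt i j m ++ rev (alt j i m).
Proof. by case=> ->. Qed.

(** The Coxeter relator is one alternating word followed by the reverse of the other, and reversal
    is inversion in the group. *)
Lemma braid_cox s t :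
  pres_eq (braidRel (B n)) s t -> pres_eq (coxRel (B n)) s t.
Proof.
apply: pres_eq_sub => _ _ [i j ij Mij]; apply/word_eqP.
have H : cw (alt i j (B n i j)) * cw (rev (alt j i (B n i j))) = 1.
  rewrite -[LHS]wordM -flatten_alt; last exact: B_weight_neq.
  by apply/word_eqP/pres_eq_rel/CoxRel.
have := cword_rev (alt j i (B n i j)); rewrite -H => /mulIg; exact: esym.
Qed.

Lemma cactw_cat s t v : cactw (s ++ t) v = cactw s (cactw t v).
Proof. exact: foldr_cat. Qed.

Lemma hactw_cat s t v : hactw (s ++ t) v = hactw s (hactw t v).
Proof. exact: foldr_cat. Qed.

Lemma cactw_rev s v : cactw s (cactw (rev s) v) = v.
Proof.
elim: s v => //= i s IH v; rewrite rev_cons -cats1 cactw_cat IH.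
exact: cactK.
Qed.

Lemma cactw_sound s t v : size v = n ->
  pres_eq (coxRel (B n)) s t -> cactw (nw s) v = cactw (nw t) v.
Proof.
move=> szv st; elim: st v szv => {s t} [s t a b Rab|s|s t _ IH|s t u _ IH1 _ IH2] v szv //.
- rewrite !map_cat !cactw_cat; congr cactw.
  have := size_cactw (nw t) v; rewrite szv; move: (cactw _ v) => {szv}v szv.
  case: Rab => i j Mij; have [<-|ij] := eqVneq i j.
    by rewrite cox_diag /= cactK.
  rewrite flatten_alt; last exact: B_weight_neq.
  rewrite map_cat cactw_cat map_rev !map_alt B_weightE.
  by rewrite cact_braid ?size_cactw ?cactw_rev.
- by rewrite IH.
- by rewrite IH1 ?IH2.
Qed.

Lemma hactw_sound s t v : size v = n ->
  pres_eq (heckeRel (B n)) s t -> hactw (nw s) v = hactw (nw t) v.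
Proof.
move=> szv st; elim: st v szv => {s t} [s t a b Rab|s|s t _ IH|s t u _ IH1 _ IH2] v szv //.
- rewrite !map_cat !hactw_cat; congr hactw.
  have := size_hactw (nw t) v; rewrite szv; move: (hactw _ v) => {szv}v szv.
  case: Rab => [i|i j ij _]; first by rewrite /= hact_idem.
  by rewrite !map_alt B_weightE hact_braid.
- by rewrite IH.
- by rewrite IH1 ?IH2.
Qed.

(** * Reduced words and Matsumoto's theorem *)

Definition reducedw s := ascw (nw s) (base n).

Lemma reducedwE s : reducedw s = (linv (cactw (nw s) (base n)) == size s).
Proof.
rewrite /reducedw ascw_linv ?generic_base ?size_base ?nw_lt //.
by rewrite linv_base addn0 size_map.
Qed.

Lemma reduced_for (v : seq int) : perm_eq (map absz v) (iota 1 n) ->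
  exists2 s, reducedw s & cactw (nw s) (base n) = v.
Proof.
case/ascw_exists=> s [als as_ Es]; have [t Et] := nw_lift als.
by exists t; rewrite /reducedw Et.
Qed.

Lemma perm_cactw_base s : perm_eq (map absz (cactw s (base n))) (iota 1 n).
Proof.
by apply: perm_trans (perm_absz_cactw _ _) _; rewrite absz_base perm_rev.
Qed.

(* Two reduced words with distinct first letters i, j are both braid equivalent
   to one starting with the longest word in i and j. *)
Lemma matsumoto s t : reducedw s -> reducedw t ->
  cactw (nw s) (base n) = cactw (nw t) (base n) -> pres_eq (braidRel (B n)) s t.
Proof.
have [k] := ubnP (size s); elim: k s t => // k IH s t lek rs rt st.
have szst : size s = size t.
  by move: rs rt; rewrite !reducedwE st => /eqP <- /eqP.
case: s t szst lek rs rt st => [|i s] [|j t] //=; first by move=> *; apply: PresRefl.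
move=> [szst] lek ais ajt st.
have [rs rt] : reducedw s /\ reducedw t by case/andP: ais => _ ?; case/andP: ajt.
have cons_eq (l : 'I_n) (u v : seq 'I_n) : pres_eq (braidRel (B n)) u v ->
  pres_eq (braidRel (B n)) (l :: u) (l :: v).
  by move=> uv; apply: (@pres_eq_cat _ _ [:: l] [:: l] _ _ (PresRefl _ _) uv).
have [eij|ij] := eqVneq i j.
  rewrite -eij in st *; apply/cons_eq/IH => //.
  exact: can_inj (cactK i) _ _ st.
set v := cact i _ in st; have szv : size v = n by rewrite size_op size_cactw size_base.
have ai : asc i (cact i v) by rewrite cactK; case/andP: ais.
have aj : asc j (cact j v) by rewrite st cactK; case/andP: ajt.
have [//|v' [h1 h2] [[w [Ew _]] Ev]] := double_descent szv (ltn_ord i) (ltn_ord j) _ ai aj.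
have [u ru Eu] : exists2 u, reducedw u & cactw (nw u) (base n) = v'.
  apply: reduced_for; rewrite Ew; apply: perm_trans (perm_absz_cactw _ _) _.
  by apply: perm_trans (perm_absz_cact _ _) _; apply: perm_cactw_base.
have szv' : size v' = n by rewrite Ew size_cactw.
have Ev2 : cactw (alt (j : nat) i (B_weight n i j)) v' = v by rewrite -cact_braid.
have half (a b : 'I_n) r : B_weight n a b = B_weight n i j -> reducedw r -> (size r < k)%N ->
    ascw (alt (a : nat) b (B_weight n i j)) v' -> cactw (alt (a : nat) b (B_weight n i j)) v' = v ->
    cact a (cactw (nw r) (base n)) = v ->
  pres_eq (braidRel (B n)) (a :: r) (alt a b (B_weight n i j) ++ u).
  move=> Eab rr szr hab Eab2 Er.
  have [m Em] : exists m, B_weight n i j = m.+1.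
    by case: (B_weight_neq ij) => ->; eexists.
  rewrite Em /= in hab Eab2 *; apply/cons_eq/IH => //.
    rewrite /reducedw map_cat ascw_cat map_alt Eu.
    by case/andP: hab => _ ->.
  rewrite map_cat cactw_cat map_alt Eu.
  by apply: can_inj (cactK a) _ _ _; rewrite Er.
apply: (PresTrans (half i j s _ rs _ h1 Ev _)) => //.
apply: PresTrans (PresSym (half j i t _ rt _ h2 Ev2 _)) => //.
- apply: pres_eq_cat (PresRefl _ _); apply: pres_eq_rel.
  by apply: (BraidRel ij); rewrite B_weightE; case: (B_weight_neq ij) => ->.
- exact: B_weightC.
- by rewrite -szst.
Qed.

Lemma reduced_desc_asc i s : reducedw s -> ~~ asc i (cactw (nw s) (base n)) -> (i < n)%N ->
  asc i (cact i (cactw (nw s) (base n))).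
Proof.
move=> rs na ltin; apply: desc_asc na; first by rewrite generic_cactw generic_base.
by rewrite size_cactw size_base.
Qed.

Lemma descent_word (i : 'I_n) s :
    reducedw s -> ~~ asc i (cactw (nw s) (base n)) ->
  exists2 u, reducedw (i :: u) & pres_eq (braidRel (B n)) s (i :: u).
Proof.
move=> rs /(reduced_desc_asc rs)/(_ (ltn_ord i)) ai.
have [u ru Eu] : exists2 u, reducedw u &
    cactw (nw u) (base n) = cact i (cactw (nw s) (base n)).
  by apply: reduced_for; apply: (perm_cactw_base (nat_of_ord i :: nw s)).
have riu : reducedw (i :: u) by rewrite /reducedw /= Eu ai.
by exists u => //; apply: matsumoto => //=; rewrite Eu cactK.
Qed.

Lemma braid_mem s t : pres_eq (braidRel (B n)) s t -> s =i t.
Proof.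
apply: pres_eq_mem => _ _ [i j ij _] x.
have m1 : (1 < B n i j)%N by rewrite B_weightE; case: (B_weight_neq ij) => ->.
by rewrite !mem_alt // !inE orbC.
Qed.

Lemma hecke_mem s t : hw s = hw t -> s =i t.
Proof.
move=> /word_eqP; apply: pres_eq_mem => _ _ [i|i j ij Mij] x.
  by rewrite !inE orbb.
have m1 : (1 < B n i j)%N by rewrite B_weightE; case: (B_weight_neq ij) => ->.
by rewrite !mem_alt // !inE orbC.
Qed.

(** A letter meeting a descent can be made the first letter of the remaining word, and the two
    cancel. The inclusion of letters keeps the result inside a parabolic subgroup. *)
Lemma cox_reduce s : exists t, [/\ reducedw t, cw s = cw t & {subset t <= s}].
Proof.
elim: s => [|i s [t [rt Et st]]]; first by exists [::].
have {}Et : cw (i :: s) = cw (i :: t).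
  by rewrite !cword_cons Et.
have sub : {subset i :: t <= i :: s}.
  by move=> x; rewrite !inE => /predU1P[->|/st ->]; rewrite ?eqxx ?orbT.
case: (boolP (asc i (cactw (nw t) (base n)))) => [ai|na].
  by exists (i :: t); split; rewrite // /reducedw /= ai.
have [u riu tu] := descent_word rt na; exists u; split.
- by case/andP: riu.
- rewrite Et; apply/word_eqP.
  apply: (@PresTrans _ _ _ ([:: i; i] ++ u)).
    exact: (pres_eq_cat (PresRefl _ [:: i]) (braid_cox tu)).
  apply: (@pres_eq_cat _ _ _ [::] u u _ (PresRefl _ _)); apply: pres_eq_rel.
  by have := @CoxRel _ (B n) i i; rewrite cox_diag; apply.
- by move=> x xu; apply/sub; rewrite inE (braid_mem tu) inE xu !orbT.
Qed.

Lemma hecke_reduce s : exists2 t, reducedw t & hw s = hw t.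
Proof.
elim: s => [|i s [t rt Et]]; first by exists [::].
have {}Et : hw (i :: s) = hw (i :: t).
  by rewrite !hword_cons Et.
case: (boolP (asc i (cactw (nw t) (base n)))) => [ai|na].
  by exists (i :: t); rewrite // /reducedw /= ai.
have [u riu tu] := descent_word rt na; exists (i :: u) => //.
rewrite Et; apply/word_eqP.
apply: (@PresTrans _ _ _ ([:: i; i] ++ u)).
  exact: (pres_eq_cat (PresRefl _ [:: i]) (braid_hecke tu)).
by apply: (@pres_eq_cat _ _ _ [:: i] u u _ (PresRefl _ _)); apply/pres_eq_rel/HeckeIdem.
Qed.

Lemma reducedw_hactw s : reducedw s -> hactw (nw s) (base n) = cactw (nw s) (base n).
Proof. exact: ascw_hactw. Qed.

(** Faithfulness: Hecke relations make both words reduced; on reduced words sorting is the group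
    action, so Matsumoto's theorem applies. *)
Lemma hword_inj s t : hactw (nw s) (base n) = hactw (nw t) (base n) -> hw s = hw t.
Proof.
have [s' rs Es] := hecke_reduce s; have [t' rt Et] := hecke_reduce t.
rewrite (hactw_sound (size_base n) (iffLR (word_eqP _ _ _) Es)).
rewrite (hactw_sound (size_base n) (iffLR (word_eqP _ _ _) Et)).
rewrite !reducedw_hactw // Es Et => /(matsumoto rs rt)/braid_hecke st.
exact/word_eqP.
Qed.

(** A reduced word attains this number, and no shorter word can, since one letter raises [linv] by
    at most one. *)
Lemma clen_cword s : clen (cw s) = linv (cactw (nw s) (base n)).
Proof.
rewrite /clen; case: ex_minnP => m /asboolP[t Et szt] min_m.
have E u : cw u = cw s -> cactw (nw u) (base n) = cactw (nw s) (base n).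
  by move=> /word_eqP us; apply: cactw_sound us; exact: size_base.
apply/eqP; rewrite eqn_leq; apply/andP; split.
  have [u [ru Eu _]] := cox_reduce s; apply: min_m; apply/asboolP; exists u => //.
  by rewrite -(E u) //; move: ru; rewrite reducedwE => /eqP.
rewrite -(E t) // -szt -(size_map (@nat_of_ord n) t).
have := @linv_cactw_le (nw t) (base n).
by rewrite linv_base addn0 generic_base size_base nw_lt; apply.
Qed.

Lemma reducedE s : reduced (B n) s <-> reducedw s.
Proof. by rewrite /reduced clen_cword reducedwE; split=> [->|/eqP]. Qed.

(** * The action of elements of the Hecke monoid *)

Definition eltact (x : Hecke (B n)) v := hactw (nw (pres_repr x)) v.

Lemma eltact_word s v : size v = n -> eltact (hw s) v = hactw (nw s) v.
Proof. by move=> szv; apply: hactw_sound szv _; apply/word_eqP; rewrite pres_reprK. Qed.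

Lemma size_eltact x v : size (eltact x v) = size v.
Proof. exact: size_hactw. Qed.

Lemma eltactM x y v : size v = n -> eltact (x * y) v = eltact x (eltact y v).
Proof.
move=> szv; rewrite -{1}(pres_reprK x) -{1}(pres_reprK y) -wordM.
by rewrite (eltact_word _ szv) map_cat hactw_cat.
Qed.

Lemma eltact_inj x y : eltact x (base n) = eltact y (base n) -> x = y.
Proof. by move=> /hword_inj; rewrite /hword !pres_reprK. Qed.

Lemma reduced_wordP w :
  reducedw (reduced_word w) /\ cw (reduced_word w) = w.
Proof.
rewrite /reduced_word; case: xgetP => [s _ [/reducedE rs Es]|H]; first by split.
have [t [rt Et _]] := cox_reduce (pres_repr w).
by case: (H t); split; [apply/reducedE|rewrite -Et; exact: pres_reprK].
Qed.

Lemma act_to_hecke s : eltact (to_hecke (cw s)) (base n) = cactw (nw s) (base n).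
Proof.
have [rr Er] := reduced_wordP (cw s).
rewrite /to_hecke eltact_word ?size_base // reducedw_hactw //.
by apply: cactw_sound; [exact: size_base|apply/word_eqP].
Qed.

Lemma to_hecke_reduced s : reducedw s -> to_hecke (cw s) = hw s.
Proof.
by move=> rs; apply: eltact_inj; rewrite act_to_hecke eltact_word ?size_base // reducedw_hactw.
Qed.

(** Hecke relations preserve the set of letters, so any word, reduced or not, shows the support. *)
Lemma hsupp_hword s : hsupp (hw s) = [set i | i \in s].
Proof.
apply/setP => i; rewrite !inE; apply/asboolP/idP => [[t [_ /hecke_mem <-]]//|ins].
have [t rt Et] := hecke_reduce s; exists t; split => //; first exact/reducedE.
by rewrite -(hecke_mem Et).
Qed.

Lemma mem_hsupp (x : Hecke (B n)) i : (i \in hsupp x) = (i \in pres_repr x).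
Proof. by rewrite -{1}(pres_reprK x) hsupp_hword inE. Qed.

(** * Absorbing elements *)

Definition absorbing (J : {set 'I_n}) (x : Hecke (B n)) :=
  hsupp x = J /\ forall j, j \in J -> hgen (B n) j * x = x /\ x * hgen (B n) j = x.

Lemma absorb_mul (J : {set 'I_n}) x s : {subset s <= J} ->
    (forall j, j \in J -> hgen (B n) j * x = x) -> hw s * x = x.
Proof.
move=> sJ Jx; elim: s sJ => [|i s IH] sJ; first exact: mul1g.
rewrite hword_cons -mulgA IH; first by apply/Jx/sJ/mem_head.
by move=> j js; apply: sJ; rewrite inE js orbT.
Qed.

Lemma absorb_mulr (J : {set 'I_n}) x s : {subset s <= J} ->
    (forall j, j \in J -> x * hgen (B n) j = x) -> x * hw s = x.
Proof.
move=> sJ Jx; elim: s sJ => [|i s IH] sJ; first exact: mulg1.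
rewrite hword_cons mulgA Jx; last by apply/sJ/mem_head.
by apply: IH => j js; apply: sJ; rewrite inE js orbT.
Qed.

Lemma hsupp_absorb (J : {set 'I_n}) (x : Hecke (B n)) : hsupp x \subset J ->
  (forall j, j \in J -> hgen (B n) j * x = x) -> hsupp x = J.
Proof.
move=> sJ Jx; apply/eqP; rewrite eqEsubset sJ; apply/subsetP => j jJ.
by rewrite -(Jx j jJ) -(pres_reprK x) -hword_cons hsupp_hword inE mem_head.
Qed.

Lemma hsupp_subset (x : Hecke (B n)) (J : {set 'I_n}) :
  hsupp x \subset J -> {subset pres_repr x <= J}.
Proof. by move=> /subsetP sJ i; rewrite -mem_hsupp; apply: sJ. Qed.

(** A word over J whose output has the most inversions cannot be changed by a further letter of J on
    the left. *)
Lemma absorbing_exists J : exists x, absorbing J x.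
Proof.
pose P m := `[< exists2 s : seq 'I_n, {subset s <= J} &
  linv (hactw (nw s) (base n)) = m >].
have exP : exists m, P m by exists 0%N; apply/asboolP; exists [::]; rewrite //= linv_base.
have ubP m : P m -> (m <= n * (2 * n))%N.
  by move=> /asboolP[s _ <-]; have := linv_le (hactw (nw s) (base n)); rewrite size_hactw size_base.
case: (ex_maxnP exP ubP) => m /asboolP[s sJ Es] maxm.
have left_s j : j \in J -> hgen (B n) j * hw s = hw s.
  move=> jJ; rewrite -hword_cons; apply: hword_inj => /=; apply: linv_hact_eq.
  apply/eqP; rewrite eqn_leq linv_hact_ge andbT Es; apply: maxm; apply/asboolP.
  by exists (j :: s) => // i; rewrite inE => /predU1P[->|/sJ].
have right_s j : j \in J -> hw (rev s) * hgen (B n) j = hw (rev s).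
  move=> /left_s; rewrite -hword_cons => /hecke_rev.
  by rewrite rev_cons -cats1 /hword wordM.
(* The product of [rev s] and [s] equals [s] by absorption on the left and [rev s] by absorption on
   the right. *)
have E : hw s = hw (rev s).
  rewrite -(absorb_mul _ left_s (s := rev s)); last by move=> i; rewrite mem_rev; apply: sJ.
  by rewrite (absorb_mulr _ right_s).
exists (hw s); split=> [|j jJ]; last by split; [exact: left_s|rewrite E; exact: right_s].
by apply: hsupp_absorb left_s; apply/subsetP => i; rewrite hsupp_hword inE; apply: sJ.
Qed.

(** One-sided absorption suffices: the product x y equals both y and x. *)
Lemma absorbing_left J x y : absorbing J x -> hsupp y \subset J ->
  (forall j, j \in J -> hgen (B n) j * y = y) -> y = x.
Proof.
move=> [sx Hx] sy Hy.
have E1 : x * y = y.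
  by rewrite -{1}(pres_reprK x); apply: absorb_mul Hy; apply: hsupp_subset; rewrite sx.
have E2 : x * y = x.
  rewrite -{1}(pres_reprK y); apply: absorb_mulr (fun j jJ => (Hx j jJ).2).
  exact: hsupp_subset.
by rewrite -E1 E2.
Qed.

Lemma absorbing_unique J x y : absorbing J x -> absorbing J y -> x = y.
Proof.
by move=> Hx [sy Hy]; apply/esym/(absorbing_left Hx); [rewrite sy|move=> j /Hy[]].
Qed.

(** An idempotent fixes its own output, hence so does each of its letters; faithfulness turns this
    into absorption on the left. *)
Lemma idem_absorbing (x : Hecke (B n)) : x * x = x -> absorbing (hsupp x) x.
Proof.
move=> xx; have left_x j : j \in hsupp x -> hgen (B n) j * x = x.
  rewrite mem_hsupp => jx; have /hactw_fix fx : eltact x (eltact x (base n)) = eltact x (base n).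
    by rewrite -eltactM ?size_base // xx.
  apply: eltact_inj; rewrite eltactM ?size_base // /hgen eltact_word ?size_eltact ?size_base //=.
  by apply: fx; rewrite map_f.
have [y Hy] := absorbing_exists (hsupp x).
by rewrite {2}(absorbing_left Hy (subxx _) left_x).
Qed.

Lemma absorbing_idem J x : absorbing J x -> x * x = x.
Proof.
move=> [sx Hx]; rewrite -{1}(pres_reprK x); apply: absorb_mul (fun j jJ => (Hx j jJ).1).
by apply: hsupp_subset; rewrite sx.
Qed.

(** * Longest elements of parabolic subgroups *)

Lemma parab_word J w :
  @parab _ (B n) J w <-> exists2 s, {subset s <= J} & w = cw s.
Proof.
split=> [|[s sJ ->]].
  move=> H; apply: (H [set w | exists2 s, {subset s <= J} & w = cw s]%classic).
  split; last by move=> _ [j jJ ->]; exists [:: j] => // i; rewrite inE => /eqP->.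
  split; first by exists [::].
  move=> _ _ [s sJ ->] [t tJ ->]; exists (s ++ rev t).
    by move=> i; rewrite mem_cat mem_rev => /orP[/sJ|/tJ].
  rewrite /cword wordM; congr (_ * _); apply: (mulgI (cw t)).
  by rewrite mulgV cword_rev.
move=> A /= [[A1 AF] AJ]; have AM x y : A x -> A y -> A (x * y).
  move=> Ax Ay; have AV : A y^-1 by rewrite -[y^-1]mul1g; apply: AF.
  by rewrite -[y]invgK; apply: AF.
elim: s sJ => [//|i s IH] sJ; rewrite cword_cons; apply: AM.
  by apply: AJ; exists i => //; apply/sJ/mem_head.
by apply: IH => j js; apply: sJ; rewrite inE js orbT.
Qed.

(** If t is a reduced word of the absorbing element and s is any reduced word over J, then t s = t
    in the monoid. So t sorts the output of s into its own: s is not longer than t, and equal length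
    forces equality. *)
Lemma longest_word (J : {set 'I_n}) : exists s,
  [/\ reducedw s, {subset s <= J}, longest (B n) J = cw s & absorbing J (hw s)].
Proof.
have [x Hx] := absorbing_exists J; have [t rt Et] := hecke_reduce (pres_repr x).
have {}Et : x = hw t by rewrite -Et /hword pres_reprK.
have tJ : {subset t <= J} by move=> i it; case: Hx; rewrite Et hsupp_hword => <- _; rewrite inE.
have max_t s : {subset s <= J} -> reducedw s -> (clen (cw s) <= clen (cw t))%N /\
  (clen (cw s) = clen (cw t) -> hw s = x).
  move=> sJ rs; have : hw (t ++ s) = hw t.
    rewrite /hword wordM -/(hw t) -/(hw s) -Et.
    by apply: absorb_mulr sJ _ => j /(Hx.2)[].
  move=> /word_eqP/(hactw_sound (size_base n)); rewrite map_cat hactw_cat => E.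
  rewrite !clen_cword -!reducedw_hactw //; split; first by rewrite -E linv_hactw_ge.
  by rewrite -E => /esym/linv_hactw_eq E'; rewrite Et; apply: hword_inj; rewrite -E E'.
have [] : @parab _ (B n) J (longest (B n) J) /\
    forall v, @parab _ (B n) J v -> (clen v <= clen (longest (B n) J))%N.
  rewrite /longest; case: xgetP => [w -> //|] /(_ (cw t)) []; split.
    by apply/parab_word; exists t.
  move=> _ /parab_word[s sJ ->]; have [s' [rs -> ss]] := cox_reduce s.
  by case: (max_t s') => // i /ss/sJ.
move=> /parab_word[s sJ Es] maxs; have [s' [rs Es' ss]] := cox_reduce s.
have s'J : {subset s' <= J} by move=> i /ss/sJ.
exists s'; split => //; first by rewrite Es.
have [le_s' ->//] := max_t s' s'J rs.
apply/eqP; rewrite eqn_leq le_s' -Es' -Es; apply: maxs.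
by apply/parab_word; exists t.
Qed.

Definition hlongest J := to_hecke (longest (B n) J).

Lemma hlongest_absorbing J : absorbing J (hlongest J).
Proof. by rewrite /hlongest; have [s [rs _ -> Hs]] := longest_word J; rewrite to_hecke_reduced. Qed.

Lemma longestE J s : reducedw s -> absorbing J (hw s) -> longest (B n) J = cw s.
Proof.
move=> rs Hs; have [t [rt tJ -> Ht]] := longest_word J.
have := absorbing_unique Ht Hs; move=> /word_eqP/(hactw_sound (size_base n)).
by rewrite !reducedw_hactw // => /(matsumoto rt rs)/braid_cox/word_eqP.
Qed.

(** The reverse of a reduced word of the absorbing element is absorbing too, and reversal is
    inversion in the group. *)
Lemma longest_invol J : longest (B n) J * longest (B n) J = 1.
Proof.
have [s [rs sJ Es Hs]] := longest_word J; rewrite {2}Es.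
have Er : hw (rev s) = hw s.
  apply: (absorbing_left Hs).
    by apply/subsetP=> i; rewrite hsupp_hword inE mem_rev; apply: sJ.
  move=> j /(Hs.2)[_]; rewrite -[X in _ -> X * _ = _]/(hw [:: j]) -[LHS]wordM => /hecke_rev.
  by rewrite rev_cat => E; rewrite -[RHS]E [RHS]wordM.
have Ev := hactw_sound (size_base n) (iffLR (word_eqP _ _ _) Er).
have rr : reducedw (rev s).
  apply: linv_hactw_ascw; rewrite Ev reducedw_hactw // linv_base addn0 size_map size_rev.
  by apply/eqP; rewrite -reducedwE.
by rewrite (longestE rr) ?Er // -[RHS](cword_rev (rev s)) revK.
Qed.

(** Reduced words are bounded in length by [linv_le], so every J is of finite type. *)
Lemma finite_parab J : finite_type (B n) J.
Proof.
have : finite_set (range (fun s : (n * (2 * n)).-bseq 'I_n => cw s)).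
  by apply: finite_image; apply: finite_finset.
apply: sub_finite_set => w _.
have [s [rs Es _]] := cox_reduce (pres_repr w).
have szs : (size s <= n * (2 * n))%N.
  move: rs; rewrite reducedwE => /eqP <-.
  by have := linv_le (cactw (nw s) (base n)); rewrite size_cactw size_base.
by exists (Bseq szs) => //=; rewrite -Es; exact: pres_reprK.
Qed.

End TypeB.

(** * Sorting blocks *)

Section Sorting.
Local Open Scope ring_scope.

Lemma hact_prefix (u v : seq int) i : hact (size u + i)%N (u ++ v) = u ++ hact i v.
Proof. by elim: u => //= x u IH; rewrite addSn /hact /= -/hact IH. Qed.

Lemma hact_suffix i (u v : seq int) : (i.+1 < size u)%N ->
  hact i (u ++ v) = hact i u ++ v.
Proof.
elim: u i => [|x u IH] [|i] //=; first by case: u {IH}.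
by rewrite ltnS => lti; rewrite /hact /= -/hact IH.
Qed.

Lemma perm_hact i (u : seq int) : (i.+1 < size u)%N -> perm_eq (hact i u) u.
Proof.
elim: u i => [|x u IH] [|i] //=; last by rewrite ltnS => /IH; rewrite perm_cons.
case: u {IH} => [|y u] //= _; rewrite /hact /=.
case: (lerP x y) => // xy.
by apply/permP => P /=; lia.
Qed.

Lemma fix_sorted (u : seq int) :
  (forall i, (i.+1 < size u)%N -> hact i u = u) -> sorted >=%R u.
Proof.
elim: u => // x u IH H; have {IH} su : sorted >=%R u.
  by apply: IH => i lti; have := H i.+1 lti; rewrite /hact /= -/hact => -[].
case: u su H => [//|y u] su /(_ 0%N isT); rewrite /hact /= => -[xy _].
by move: su => /= ->; rewrite andbT; lia.
Qed.

Lemma fix_nonneg (u : seq int) :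
  (forall i, (i < size u)%N -> hact i u = u) -> all (>= 0) u.
Proof.
elim: u => // x u IH H; have {IH} su : all (>= 0) u.
  by apply: IH => i lti; have := H i.+1 lti; rewrite /hact /= -/hact => -[].
move: (H 0%N isT); rewrite /= su andbT; move: su; case: u {H} => [_|y u].
  by rewrite /hact /= => -[]; lia.
by rewrite /hact /= => /andP[y0 _] [+ _]; lia.
Qed.

Lemma map_norm_nonneg (u : seq int) : all (>= 0) u -> map Num.norm u = u.
Proof.
by move=> /allP u0; rewrite -[RHS]map_id; apply/eq_in_map => x /u0; apply: ger0_norm.
Qed.

Lemma map_norm_opp (u : seq int) : map Num.norm (map -%R u) = map Num.norm u.
Proof. by rewrite -map_comp; apply: eq_map => x /=; rewrite normrN. Qed.

Lemma perm_norm_hact i (u : seq int) :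
  perm_eq (map Num.norm (hact i u)) (map Num.norm u).
Proof.
have E (v : seq int) : map Num.norm v = map Posz (map absz v) :> seq int.
  by rewrite -map_comp; apply: eq_map => x /=; rewrite abszE.
by rewrite !E perm_map // perm_absz_hact.
Qed.

Variable n : nat.
Implicit Types (J : {set 'I_n}) (x : Hecke (B n)).

Lemma absorbing_fix J x v i : absorbing J x -> size v = n -> i \in J ->
  hact i (eltact x v) = eltact x v.
Proof.
move=> [_ Hx] szv iJ; rewrite -{2}(Hx i iJ).1 eltactM //.
by rewrite /hgen eltact_word ?size_eltact.
Qed.

Lemma absorbing_repr J x : absorbing J x -> {subset pres_repr x <= J}.
Proof. by case=> sx _; apply: hsupp_subset; rewrite sx. Qed.

(** The outcome permutes the block and is fixed by all generators of J, which leaves only the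
    decreasing arrangement. A block of N entries has N - 1 generators, whence [i.+1]. *)
Lemma act_sort J x (pre u u' tl : seq int) : absorbing J x ->
    size (pre ++ u ++ tl) = n ->
    (forall i, (i \in J) = ((size pre <= i) && (i.+1 < size pre + size u))%N) ->
    perm_eq u u' -> pairwise >=%R u' ->
  eltact x (pre ++ u ++ tl) = pre ++ u' ++ tl.
Proof.
move=> Hx szv EJ uu' su'.
have [u1 Eu1 pu1] : exists2 u1, eltact x (pre ++ u ++ tl) = pre ++ u1 ++ tl & perm_eq u1 u.
  rewrite /eltact; elim: (pres_repr x) (absorbing_repr Hx) => [|i s IH] sJ; first by exists u.
  have [|u1 /= -> pu1] := IH; first by move=> j js; apply: sJ; rewrite inE js orbT.
  have := sJ i (mem_head _ _); rewrite EJ => /andP[lei lti].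
  have szu1 : size u1 = size u := perm_size pu1.
  have lti' : ((i - size pre).+1 < size u1)%N by rewrite szu1; lia.
  rewrite -(subnKC lei) hact_prefix hact_suffix //; exists (hact (i - size pre) u1) => //.
  by apply: perm_trans pu1; apply: perm_hact.
have szu1 : size u1 = size u := perm_size pu1.
rewrite Eu1; congr (_ ++ (_ ++ _)); apply: (sorted_eq ge_trans).
- exact: ge_anti.
- apply: fix_sorted => i lti; rewrite szu1 in lti.
  have ltin : (size pre + i < n)%N by rewrite -szv !size_cat; lia.
  have := absorbing_fix (i := Ordinal ltin) Hx szv.
  rewrite EJ Eu1 /= hact_prefix hact_suffix ?szu1 // => /(_ _)/eqP.
  rewrite eqseq_cat // eqxx eqseq_cat ?size_op // eqxx andbT => H.
  by apply/eqP/H; lia.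
- exact: pairwise_sorted.
- exact: perm_trans pu1 uu'.
Qed.

(** With the last index in J only absolute values are preserved, and being fixed also means being
    nonnegative. *)
Lemma act_sort_norm J x (pre u u' : seq int) : absorbing J x ->
    size (pre ++ u) = n ->
    (forall i, (i \in J) = (size pre <= i)%N) ->
    perm_eq (map Num.norm u) u' -> pairwise >=%R u' ->
  eltact x (pre ++ u) = pre ++ u'.
Proof.
move=> Hx szv EJ uu' su'.
have [u1 Eu1 pu1] : exists2 u1, eltact x (pre ++ u) = pre ++ u1 &
    perm_eq (map Num.norm u1) (map Num.norm u).
  rewrite /eltact; elim: (pres_repr x) (absorbing_repr Hx) => [|i s IH] sJ; first by exists u.
  have [|u1 /= -> pu1] := IH; first by move=> j js; apply: sJ; rewrite inE js orbT.
  have := sJ i (mem_head _ _); rewrite EJ => lei.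
  rewrite -(subnKC lei) hact_prefix; exists (hact (i - size pre) u1) => //.
  by apply: perm_trans pu1; apply: perm_norm_hact.
have szu1 : size u1 = size u by move/perm_size: pu1; rewrite !size_map.
have fu1 i : (i < size u1)%N -> hact i u1 = u1.
  move=> lti; have ltin : (size pre + i < n)%N by rewrite -szv size_cat; lia.
  have := absorbing_fix (i := Ordinal ltin) Hx szv.
  rewrite EJ Eu1 /= hact_prefix leq_addr => /(_ isT)/eqP.
  by rewrite eqseq_cat // eqxx => /eqP.
rewrite Eu1; congr (_ ++ _); apply: (sorted_eq ge_trans).
- exact: ge_anti.
- by apply: fix_sorted => i lti; apply: fu1; lia.
- exact: pairwise_sorted.
- by rewrite -[u1]map_norm_nonneg ?fix_nonneg //; exact: perm_trans pu1 uu'.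
Qed.

End Sorting.

Section Blocks.
Local Open Scope ring_scope.

Definition neg (s : seq int) := map -%R s.

Lemma size_neg s : size (neg s) = size s.
Proof. exact: size_map. Qed.

Lemma neg_cat s t : neg (s ++ t) = neg s ++ neg t.
Proof. exact: map_cat. Qed.

Lemma pairwise_revneg s : pairwise >=%R (rev (neg s)) = pairwise >=%R s.
Proof.
rewrite -!(sorted_pairwise ge_trans) rev_sorted sorted_map.
by apply: eq_sorted => x y /=; lia.
Qed.

Lemma allrel_pos_neg (s t : seq int) : all (> 0) s -> all (> 0) t -> allrel >=%R s (neg t).
Proof.
move=> /allP s0 /allP t0; apply/allrelP => x _ xs /mapP[y yt ->].
by have := s0 x xs; have := t0 y yt; rewrite /=; lia.
Qed.

Lemma norm_pos (s : seq int) : all (> 0) s -> map Num.norm s = s.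
Proof. by move=> s0; apply: map_norm_nonneg; apply: sub_all s0 => x /ltW. Qed.

Lemma norm_neg (s : seq int) : all (> 0) s -> map Num.norm (neg s) = s.
Proof. by move=> s0; rewrite map_norm_opp norm_pos. Qed.

Definition top n : seq int := neg (base n).

Lemma size_top n : size (top n) = n.
Proof. by rewrite size_neg size_base. Qed.

Lemma base_top n : base n = neg (top n).
Proof. by rewrite /top /neg -map_comp -[LHS]map_id; apply: eq_map => x /=; rewrite opprK. Qed.

Lemma top_pos n : all (> 0) (top n).
Proof. by rewrite all_map; apply: sub_all (base_neg n) => x /=; lia. Qed.

Lemma top_gt n : pairwise >%R (top n).
Proof.
rewrite pairwise_map; have := base_sorted n; rewrite (sorted_pairwise lt_trans).
by apply: sub_pairwise => x y /=; lia.
Qed.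

Lemma top_ge n : pairwise >=%R (top n).
Proof. by apply: sub_pairwise (top_gt n) => x y /ltW. Qed.

Lemma top_split n a b c : n = (a + b + c)%N -> exists U V W,
  [/\ top n = U ++ V ++ W, size U = a, size V = b & size W = c].
Proof.
move=> En; exists (take a (top n)), (take b (drop a (top n))), (drop b (drop a (top n))).
by rewrite !cat_take_drop !size_take_min !size_drop size_top; split=> //; lia.
Qed.

End Blocks.

(** * Products of two absorbing elements when the second interval ends at n *)

Section TypeBBlocks.
Local Open Scope ring_scope.
Variables (n p m q : nat) (J K : {set 'I_n}) (a b : Hecke (B n)).
Hypothesis En : n = (p + m + q)%N.
Hypothesis Ha : absorbing J a.
Hypothesis Hb : absorbing K b.
Hypothesis EJ : forall i : 'I_n, (i \in J) = (i.+1 < p + m)%N.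
Hypothesis EK : forall i : 'I_n, (i \in K) = (p <= i)%N.

Let sort_a (u u' t : seq int) : size u = (p + m)%N -> size t = q ->
  perm_eq u u' -> pairwise >=%R u' -> eltact a (u ++ t) = u' ++ t.
Proof.
move=> su st; apply: (@act_sort _ J a [::] u u' t) => //.
- by rewrite cat0s size_cat su st.
- by move=> i; rewrite EJ add0n su.
Qed.

Let sort_b (s u u' : seq int) : size s = p -> size u = (m + q)%N ->
  perm_eq (map Num.norm u) u' -> pairwise >=%R u' -> eltact b (s ++ u) = s ++ u'.
Proof.
move=> ss su; apply: (@act_sort_norm _ K b s u u') => //.
  by rewrite size_cat su ss En addnA.
by move=> i; rewrite EK ss.
Qed.

(** The first a moves the p entries of -V to the front, out of reach of b, so they stay negative. *)
Lemma aba_value (U V W : seq int) : top n = U ++ V ++ W ->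
    size U = m -> size V = p -> size W = q ->
  eltact a (eltact b (eltact a (base n))) = U ++ rev (neg V) ++ W.
Proof.
move=> ET sU sV sW.
have := top_pos n; rewrite ET !all_cat => /and3P[U0 V0 W0].
have := top_ge n; rewrite ET !pairwise_cat allrel_catr.
move=> /and3P[/andP[UV UW] dU /and3P[VW dV dW]].
rewrite base_top ET !neg_cat catA.
rewrite (@sort_a _ (rev (neg V) ++ rev (neg U))); first last.
- by rewrite -rev_cat -neg_cat pairwise_revneg pairwise_cat UV dU dV.
- by rewrite -rev_cat perm_sym perm_rev.
- by rewrite size_neg.
- by rewrite size_cat !size_neg sU sV addnC.
rewrite -catA (@sort_b _ _ (U ++ W)); first last.
- by rewrite pairwise_cat UW dU dW.
- by rewrite map_cat map_rev !norm_neg // perm_cat2r perm_rev.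
- by rewrite size_cat size_rev !size_neg sU sW.
- by rewrite size_rev size_neg.
rewrite catA (@sort_a _ (U ++ rev (neg V))) ?catA //.
- by rewrite size_cat size_rev size_neg sU sV.
- by rewrite perm_catC.
- by rewrite pairwise_cat allrel_revr allrel_pos_neg // dU pairwise_revneg.
Qed.

(** a brings the entries of -U within reach of b, but thereby puts V into the first p places, where
    the last b leaves it. *)
Lemma bab_value (U V V' W : seq int) : top n = U ++ (V ++ V') ++ W ->
    size U = p -> size V = p -> size (V ++ V') = m -> size W = q ->
  eltact b (eltact a (eltact b (base n))) = V ++ U ++ V' ++ W.
Proof.
move=> ET sU sV sVV sW.
have := top_pos n; rewrite ET !all_cat => /and3P[U0 /andP[V0 V'0] W0].
have := top_ge n; rewrite ET pairwise_cat allrel_catr (pairwise_cat _ (V ++ V')).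
move=> /and3P[/andP[UV UW] dU /and3P[VW dV dW]].
rewrite base_top ET (neg_cat U) (@sort_b _ _ ((V ++ V') ++ W)); first last.
- by rewrite pairwise_cat VW dV dW.
- by rewrite norm_neg ?all_cat ?V0 ?V'0.
- by rewrite size_neg size_cat sVV sW.
- by rewrite size_neg.
rewrite catA (@sort_a _ ((V ++ V') ++ rev (neg U))); first last.
- by rewrite pairwise_cat allrel_revr allrel_pos_neg ?all_cat ?V0 ?V'0 // dV pairwise_revneg.
- by rewrite perm_catC perm_cat2l perm_sym perm_rev.
- by [].
- by rewrite size_cat size_neg sU sVV.
move: UV VW dV; rewrite pairwise_cat allrel_catr allrel_catl.
move=> /andP[UV UV'] /andP[VW V'W] /and3P[VV' dV dV'].
rewrite -!catA (@sort_b _ _ (U ++ V' ++ W)) //.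
- by move: sVV; rewrite !size_cat size_rev size_neg sU sV sW; clear; lia.
- rewrite !map_cat map_rev norm_neg // !norm_pos //.
  by rewrite perm_catCA perm_cat2r perm_rev.
- by rewrite !pairwise_cat allrel_catr UV' UW dU V'W dV' dW.
Qed.

Lemma baba_value : (p <= m)%N -> eltact b (eltact a (eltact b (eltact a (base n)))) = top n.
Proof.
move=> le_pm; have [U [V [W [ET sU sV sW]]]] : exists U V W,
  [/\ top n = U ++ V ++ W, size U = m, size V = p & size W = q].
  by apply: top_split; rewrite En; lia.
rewrite (aba_value ET) //.
have := top_pos n; rewrite ET !all_cat => /and3P[U0 V0 W0].
have := top_ge n; rewrite ET.
rewrite -(cat_take_drop p U) -catA.
set U1 := take p U; set U2 := drop p U; rewrite pairwise_cat => /and3P[_ _ dr].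
have sU1 : size U1 = p by rewrite size_take_min sU; lia.
have U20 : all (> 0) U2 by move: U0; rewrite -{1}(cat_take_drop p U) all_cat => /andP[].
rewrite -!catA (@sort_b _ _ (U2 ++ V ++ W)) //.
- by rewrite !size_cat size_rev size_neg size_drop sU sV sW; lia.
- rewrite !map_cat map_rev norm_neg // !norm_pos //.
  by rewrite perm_cat2l perm_cat2r perm_rev.
Qed.

Lemma abab_value : (p <= m)%N -> eltact a (eltact b (eltact a (eltact b (base n)))) = top n.
Proof.
move=> le_pm; have [U [V [W [ET sU sV sW]]]] := top_split En.
have := ET; rewrite -(cat_take_drop p V); set V1 := take p V; set V2 := drop p V => ET'.
have sV1 : size V1 = p by rewrite size_take_min sV; lia.
have EV : V1 ++ V2 = V by rewrite cat_take_drop.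
rewrite (bab_value ET') ?EV // ET' EV.
have := top_ge n; rewrite ET catA pairwise_cat => /and3P[_ dUV _].
have -> : V1 ++ U ++ V2 ++ W = (V1 ++ U ++ V2) ++ W by rewrite -!catA.
rewrite (@sort_a _ (U ++ V)) -?catA //.
- by rewrite !size_cat sU sV1 size_drop sV; lia.
- by rewrite -EV perm_catCA.
Qed.

Lemma hom_relation : (p <= m)%N -> (a * b * a * b = b * a * b * a)%g.
Proof.
move=> le_pm; apply: eltact_inj; rewrite !eltactM ?size_eltact ?size_base //.
by rewrite baba_value // abab_value.
Qed.

Lemma aba_neq : (0 < p)%N -> (p <= m)%N -> (a * b * a <> a * b * a * b)%g.
Proof.
move=> p0 le_pm; have [U [V [W [ET sU sV sW]]]] : exists U V W,
  [/\ top n = U ++ V ++ W, size U = m, size V = p & size W = q].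
  by apply: top_split; rewrite En; lia.
move=> /(congr1 (fun x => eltact x (base n))); rewrite !eltactM ?size_eltact ?size_base //.
rewrite (aba_value ET) // abab_value // => E; have := top_pos n.
rewrite -{1}E !all_cat all_rev => /and3P[_ nV _]; have := top_pos n.
rewrite ET !all_cat => /and3P[_ pV _].
case: V sV pV nV {ET E} => [E|x V _] /=; first by rewrite -E in p0.
by move=> /andP[x0 _] /andP[nx0 _]; lia.
Qed.

Lemma bab_neq : (0 < p)%N -> (p <= m)%N -> (b * a * b <> a * b * a * b)%g.
Proof.
move=> p0 le_pm; have [U [V [W [ET sU sV sW]]]] := top_split En.
have := ET; rewrite -(cat_take_drop p V); set V1 := take p V; set V2 := drop p V => ET'.
have sV1 : size V1 = p by rewrite size_take_min sV; lia.
move=> /(congr1 (fun x => eltact x (base n))); rewrite !eltactM ?size_eltact ?size_base //.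
rewrite abab_value // (bab_value ET') ?cat_take_drop // ET' => /eqP.
rewrite eqseq_cat ?sV1 ?sU // => /andP[/eqP EV1 _].
have := top_gt n; rewrite ET' EV1 pairwise_cat !allrel_catr -andbA.
case: U sU {ET ET' EV1} => [E|x U _]; first by rewrite -E in p0.
by rewrite allrel_consl /= ltxx.
Qed.

End TypeBBlocks.

(** * Tests on sequences with few values, and intervals that miss n *)

Section TokenBlocks.
Local Open Scope ring_scope.

Lemma pairwise_nseq k (x : int) : pairwise >=%R (nseq k x).
Proof. by elim: k => //= k ->; rewrite all_nseq /= lexx orbT. Qed.

Lemma allrel_nseq k l (x y : int) : y <= x -> allrel >=%R (nseq k x) (nseq l y).
Proof. by move=> yx; apply/allrelP => u v /nseqP[-> _] /nseqP[-> _]. Qed.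

Lemma map_norm_nseq k (x : int) : map Num.norm (nseq k x) = nseq k `|x|.
Proof. by rewrite map_nseq. Qed.

Variables (n r p m q : nat) (J K Z : {set 'I_n}) (a b z : Hecke (B n)).
Hypothesis Ha : absorbing J a.
Hypothesis Hb : absorbing K b.
Hypothesis Hz : absorbing Z z.

(* With m < p, one of the p entries -1 keeps its sign throughout. *)
Lemma typeB_obstruction : n = (r + p + m + q)%N ->
    (forall i : 'I_n, (i \in J) = (r <= i)%N && (i.+1 < r + p + m)%N) ->
    (forall i : 'I_n, (i \in K) = (r + p <= i)%N) ->
    (forall i : 'I_n, (i \in Z) = (r <= i)%N) ->
  (m < p)%N -> (a * b * a * b)%g <> z.
Proof.
move=> En EJ EK EZ lt_mp; pose o k := nseq k (0 : int); pose l k := nseq k 1%:Z.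
pose w k := nseq k (- 1%:Z).
have so k : size (o k) = k by rewrite size_nseq.
have sl k : size (l k) = k by rewrite size_nseq.
have sw k : size (w k) = k by rewrite size_nseq.
have po k : pairwise >=%R (o k) by apply: pairwise_nseq.
have pl k : pairwise >=%R (l k) by apply: pairwise_nseq.
have pw k : pairwise >=%R (w k) by apply: pairwise_nseq.
have lo x y : allrel >=%R (l x) (o y) by apply: allrel_nseq.
have lw x y : allrel >=%R (l x) (w y) by apply: allrel_nseq.
have ow x y : allrel >=%R (o x) (w y) by apply: allrel_nseq.
have no k : map Num.norm (o k) = o k by rewrite map_norm_nseq.
have nw k : map Num.norm (w k) = l k by rewrite map_norm_nseq normrN1.
have Ew : w p = w (p - m)%N ++ w m by rewrite /w -nseqD subnK // ltnW.
(* Every sequence of length n is acted on, so one with repeated entries may separate two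
   elements. *)
pose T := o r ++ w p ++ o m ++ o q.
have szT : size T = n by rewrite !size_cat !so sw; lia.
move=> /(congr1 (fun x => eltact x T)); rewrite !eltactM ?size_eltact //.
have -> : eltact z T = o r ++ l p ++ o m ++ o q.
  apply: (act_sort_norm Hz) => //; first by move=> i; rewrite EZ so.
  - by rewrite !map_cat nw !no.
  - by rewrite !pairwise_cat !allrel_catr !lo pl !po allrel_nseq.
have -> : eltact b T = o r ++ (w p ++ o m) ++ o q.
  have -> : o r ++ (w p ++ o m) ++ o q = (o r ++ w p) ++ (o m ++ o q) by rewrite -!catA.
  rewrite /T (catA (o r)); apply: (act_sort_norm Hb).
  - by rewrite !size_cat !so sw; lia.
  - by move=> i; rewrite EK !size_cat so sw; lia.
  - by rewrite map_cat !no.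
  - by rewrite !pairwise_cat !po allrel_nseq.
rewrite (act_sort (u' := o m ++ w p) Ha); first last.
- by rewrite pairwise_cat ow po pw.
- by rewrite perm_catC.
- by move=> i; rewrite EJ !size_cat !so sw; lia.
- by rewrite !size_cat !so sw; lia.
(* Only the last m of the entries -1 lie within reach of b. *)
have -> : o r ++ (o m ++ w p) ++ o q = (o r ++ o m ++ w (p - m)%N) ++ (w m ++ o q).
  by rewrite Ew -!catA.
rewrite (act_sort_norm (u' := l m ++ o q) Hb); first last.
- by rewrite pairwise_cat lo pl po.
- by rewrite map_cat nw no.
- by move=> i; rewrite EK !size_cat !so sw; lia.
- by rewrite !size_cat !so !sw; lia.
have -> : (o r ++ o m ++ w (p - m)%N) ++ (l m ++ o q) =
    o r ++ (o m ++ w (p - m)%N ++ l m) ++ o q by rewrite -!catA.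
rewrite (act_sort (u' := l m ++ o m ++ w (p - m)%N) Ha); first last.
- by rewrite !pairwise_cat !allrel_catr lo lw ow pl po pw.
- by apply/permP => P; rewrite !count_cat; lia.
- by move=> i; rewrite EJ !size_cat !so sw sl; lia.
- by rewrite !size_cat !so sw sl; lia.
move=> /(congr1 (all (>= 0))); rewrite !all_cat !all_nseq /= !orbT /=.
by rewrite orbF subn_eq0 leqNgt lt_mp.
Qed.

Variable t : nat.
Hypothesis En : n = (r + p + m + q + t)%N.
Hypothesis EJ : forall i : 'I_n, (i \in J) = (r <= i)%N && (i.+1 < r + p + m)%N.
Hypothesis EK : forall i : 'I_n,
  (i \in K) = (r + p <= i)%N && (i.+1 < r + p + m + q)%N.
Hypothesis EZ : forall i : 'I_n, (i \in Z) = (r <= i)%N && (i.+1 < r + p + m + q)%N.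

(* Only m of the m + 1 entries 1 reach the first block in time. *)
Lemma typeA_obstruction : (m < p)%N -> (m < q)%N -> (b * a * b * a)%g <> z.
Proof.
move=> lt_mp lt_mq; pose o k := nseq k (0 : int); pose l k := nseq k 1%:Z.
have Eo x y : o (x + y)%N = o x ++ o y by rewrite /o nseqD.
have El x y : l (x + y)%N = l x ++ l y by rewrite /l nseqD.
have so k : size (o k) = k by rewrite size_nseq.
have sl k : size (l k) = k by rewrite size_nseq.
have po k : pairwise >=%R (o k) by apply: pairwise_nseq.
have pl k : pairwise >=%R (l k) by apply: pairwise_nseq.
have lo x y : allrel >=%R (l x) (o y) by apply: allrel_nseq.
(* [q'] pads the last block around m + 1 ones; [p' + 1] zeros end up between the first m ones and
   the last one. *)
have Ep : p = ((p - m.+1) + 1 + m)%N by lia.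
have Eq : q = ((q - m.+1) + (m + 1))%N by lia.
set p' := (p - m.+1)%N in Ep; set q' := (q - m.+1)%N in Eq.
pose T := o r ++ (o p ++ o m) ++ (o q' ++ l (m + 1)%N) ++ o t.
have szT : size T = n by rewrite !size_cat !so !sl; lia.
move=> /(congr1 (fun x => eltact x T)); rewrite !eltactM ?size_eltact //.
have -> : eltact z T = o r ++ (l (m + 1)%N ++ o (p + m + q')%N) ++ o t.
  have -> : T = o r ++ (o p ++ o m ++ o q' ++ l (m + 1)%N) ++ o t by rewrite /T -!catA.
  apply: (act_sort Hz).
  - by rewrite -szT /T -!catA.
  - by move=> i; rewrite EZ !size_cat !so !sl; lia.
  - by apply/permP => P; rewrite !Eo !count_cat; lia.
  - by rewrite pairwise_cat lo pl po.
have -> : eltact a T = (o r ++ o p) ++ (o m ++ o q' ++ l (m + 1)%N) ++ o t.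
  have -> : (o r ++ o p) ++ (o m ++ o q' ++ l (m + 1)%N) ++ o t = T by rewrite /T -!catA.
  apply: (act_sort Ha) => //.
  - by move=> i; rewrite EJ !size_cat !so; lia.
  - by rewrite -Eo.
rewrite (act_sort (u' := l (m + 1)%N ++ o (m + q')%N) Hb); first last.
- by rewrite pairwise_cat lo pl po.
- by apply/permP => P; rewrite !Eo !count_cat; lia.
- by move=> i; rewrite EK !size_cat !so !sl; lia.
- by rewrite !size_cat !so !sl; lia.
have -> : (o r ++ o p) ++ (l (m + 1)%N ++ o (m + q')%N) ++ o t =
    o r ++ (o p ++ l m) ++ l 1%N ++ o (m + q')%N ++ o t by rewrite El -!catA.
rewrite (act_sort (u' := l m ++ o p) Ha); first last.
- by rewrite pairwise_cat lo pl po.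
- by rewrite perm_catC.
- by move=> i; rewrite EJ !size_cat !so !sl; lia.
- by rewrite !size_cat !so !sl; lia.
have -> : o r ++ (l m ++ o p) ++ l 1%N ++ o (m + q')%N ++ o t =
    (o r ++ l m ++ o p' ++ o 1%N) ++ (o m ++ l 1%N ++ o (m + q')%N) ++ o t.
  by rewrite {1}Ep !Eo -!catA.
rewrite (act_sort (u' := l 1%N ++ o (m + (m + q'))%N) Hb); first last.
- by rewrite pairwise_cat lo pl po.
- by apply/permP => P; rewrite !Eo !count_cat; lia.
- by move=> i; rewrite EK !size_cat !so !sl; lia.
- by rewrite !size_cat !so !sl; lia.
rewrite -Eo addnC Eo El -!catA => /eqP.
by rewrite eqseq_cat // eqxx eqseq_cat // eqxx.
Qed.

Let base_le : pairwise <=%R (base n).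
Proof.
have := base_sorted n; rewrite (sorted_pairwise lt_trans).
by apply: sub_pairwise => x y /ltW.
Qed.

Let pairwise_rev (s : seq int) : pairwise >=%R (rev s) = pairwise <=%R s.
Proof. by rewrite -(sorted_pairwise ge_trans) -(sorted_pairwise le_trans) rev_sorted. Qed.

Let base_split (A0 A1 A2 A3 A4 : nat) :
  n = (A0 + A1 + A2 + A3 + A4 + t)%N -> exists X0 X1 X2 X3 X4 X5,
  base n = X0 ++ X1 ++ X2 ++ X3 ++ X4 ++ X5 /\
  [/\ size X0 = A0, size X1 = A1, size X2 = A2, size X3 = A3 & size X4 = A4].
Proof.
move=> E; set s := base n; have : size s = n by apply: size_base.
move: s => s sz.
exists (take A0 s), (take A1 (drop A0 s)), (take A2 (drop A1 (drop A0 s))).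
exists (take A3 (drop A2 (drop A1 (drop A0 s)))).
exists (take A4 (drop A3 (drop A2 (drop A1 (drop A0 s))))).
exists (drop A4 (drop A3 (drop A2 (drop A1 (drop A0 s))))).
by rewrite !cat_take_drop !size_take_min !size_drop sz; split=> //; split; lia.
Qed.

(** All the sorted blocks below are reversals of subsequences of the increasing sequence
    [base n]. *)
Local Ltac sub_pairwise H :=
  rewrite pairwise_rev; move: H; rewrite !pairwise_cat !allrel_catr;
  clear; move=> H;
  repeat match goal with E : is_true (_ && _) |- _ => case/andP: E => ? ? end;
  by do ![apply/andP; split].

(** The overlap has room for the q smallest entries Ua and then for the q largest X: a single b
    exchanges them across the overlap, and the last a brings X to the front. *)
Lemma typeA_aba : (q <= m)%N -> (a * b * a)%g = z.
Proof.
move=> le_qm; have [|R [Ua [Ub [V [X [T [EX [sR sUa sUb sV sX]]]]]]]] :=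
  @base_split r q (m - q) p q; first lia.
have szT : size T = t.
  by have := size_base n; rewrite EX !size_cat sR sUa sUb sV sX; lia.
apply: eltact_inj; rewrite !eltactM ?size_eltact ?size_base //.
have H := base_le; rewrite EX in H.
have -> : eltact z (base n) = R ++ rev (Ua ++ Ub ++ V ++ X) ++ T.
  have -> : base n = R ++ (Ua ++ Ub ++ V ++ X) ++ T by rewrite EX -!catA.
  apply: (act_sort Hz).
  - by rewrite !size_cat sR sUa sUb sV sX szT; lia.
  - by move=> i; rewrite EZ !size_cat sR sUa sUb sV sX; lia.
  - by rewrite perm_sym perm_rev.
  - sub_pairwise H.
have -> : base n = R ++ (Ua ++ Ub ++ V) ++ X ++ T by rewrite EX -!catA.
rewrite (act_sort (u' := rev (Ua ++ Ub ++ V)) Ha); first last.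
- sub_pairwise H.
- by rewrite perm_sym perm_rev.
- by move=> i; rewrite EJ !size_cat sR sUa sUb sV; lia.
- by rewrite !size_cat sR sUa sUb sV sX szT; lia.
have -> : R ++ rev (Ua ++ Ub ++ V) ++ X ++ T =
    (R ++ rev V) ++ (rev (Ua ++ Ub) ++ X) ++ T by rewrite !rev_cat -!catA.
rewrite (act_sort (u' := rev (Ua ++ Ub ++ X)) Hb); first last.
- sub_pairwise H.
- by apply/permP => P; rewrite !rev_cat !count_cat !count_rev; lia.
- by move=> i; rewrite EK !size_cat !size_rev !size_cat sR sUa sUb sV sX; lia.
- by rewrite !size_cat !size_rev !size_cat sR sUa sUb sV sX szT; lia.
have -> : (R ++ rev V) ++ rev (Ua ++ Ub ++ X) ++ T =
    R ++ (rev V ++ rev X ++ rev Ub) ++ rev Ua ++ T by rewrite !rev_cat -!catA.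
rewrite (act_sort (u' := rev (Ub ++ V ++ X)) Ha); first last.
- sub_pairwise H.
- by apply/permP => P; rewrite !rev_cat !count_cat !count_rev; lia.
- by move=> i; rewrite EJ !size_cat !size_rev sR sUb sV sX; lia.
- by rewrite !size_cat !size_rev sR sUa sUb sV sX szT; lia.
by rewrite !rev_cat -!catA.
Qed.

(** The mirror image: a single a exchanges the p smallest entries X with the p largest Ya through
    the overlap. *)
Lemma typeA_bab : (p <= m)%N -> (b * a * b)%g = z.
Proof.
move=> le_pm; have [|R [X [W [Yb [Ya [T [EX [sR sX sW sYb sYa]]]]]]]] :=
  @base_split r p q (m - p) p; first lia.
have szT : size T = t.
  by have := size_base n; rewrite EX !size_cat sR sX sW sYb sYa; lia.
apply: eltact_inj; rewrite !eltactM ?size_eltact ?size_base //.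
have H := base_le; rewrite EX in H.
have -> : eltact z (base n) = R ++ rev (X ++ W ++ Yb ++ Ya) ++ T.
  have -> : base n = R ++ (X ++ W ++ Yb ++ Ya) ++ T by rewrite EX -!catA.
  apply: (act_sort Hz).
  - by rewrite !size_cat sR sX sW sYb sYa szT; lia.
  - by move=> i; rewrite EZ !size_cat sR sX sW sYb sYa; lia.
  - by rewrite perm_sym perm_rev.
  - sub_pairwise H.
have -> : base n = (R ++ X) ++ (W ++ Yb ++ Ya) ++ T by rewrite EX -!catA.
rewrite (act_sort (u' := rev (W ++ Yb ++ Ya)) Hb); first last.
- sub_pairwise H.
- by rewrite perm_sym perm_rev.
- by move=> i; rewrite EK !size_cat sR sX sW sYb sYa; lia.
- by rewrite !size_cat sR sX sW sYb sYa szT; lia.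
have -> : (R ++ X) ++ rev (W ++ Yb ++ Ya) ++ T =
    R ++ (X ++ rev (Yb ++ Ya)) ++ rev W ++ T by rewrite !rev_cat -!catA.
rewrite (act_sort (u' := rev (X ++ Yb ++ Ya)) Ha); first last.
- sub_pairwise H.
- by apply/permP => P; rewrite !rev_cat !count_cat !count_rev; lia.
- by move=> i; rewrite EJ !size_cat !size_rev !size_cat sR sX sYb sYa; lia.
- by rewrite !size_cat !size_rev !size_cat sR sX sW sYb sYa szT; lia.
have -> : R ++ rev (X ++ Yb ++ Ya) ++ rev W ++ T =
    (R ++ rev Ya) ++ (rev Yb ++ rev X ++ rev W) ++ T by rewrite !rev_cat -!catA.
rewrite (act_sort (u' := rev (X ++ W ++ Yb)) Hb); first last.
- sub_pairwise H.
- by apply/permP => P; rewrite !rev_cat !count_cat !count_rev; lia.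
- by move=> i; rewrite EK !size_cat !size_rev sR sX sW sYb sYa; lia.
- by rewrite !size_cat !size_rev sR sX sW sYb sYa szT; lia.
by rewrite !rev_cat -!catA.
Qed.

End TokenBlocks.

(** * Relative longest elements, and the Hecke monoid of B_2 *)

Section ParabolicShape.
Local Open Scope ring_scope.

Lemma asc_suffix (u v : seq int) i : asc (size u + i) (u ++ v) = asc i v.
Proof. by elim: u => //= x u IH; rewrite addSn. Qed.

Lemma asc_prefix (u v : seq int) i : sorted <%R u -> (i.+1 < size u)%N -> asc i (u ++ v).
Proof.
elim: u i => [|x u IH] [|i] //=.
  by case: u {IH} => [|y u] //= /andP[].
by move=> /path_sorted su; rewrite ltnS => /(IH _ su).
Qed.

Lemma asc_sorted_neg (u : seq int) i : sorted <%R u -> all (< 0) u -> (i < size u)%N ->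
  asc i u.
Proof.
elim: u i => [|x u IH] [|i] //=.
  by case: u {IH} => [|y u] /= => [_ /andP[]|/andP[]].
by move=> /path_sorted su /andP[_ nu]; rewrite ltnS; apply: IH.
Qed.

Lemma cactw_neg s v : cactw s (neg v) = neg (cactw s v).
Proof.
have cact_neg i u : cact i (neg u) = neg (cact i u).
  elim: u i => [|x u IH] [|i] //=; last by rewrite /cact /= -/cact IH.
  by case: u {IH}.
by elim: s => //= i s IH; rewrite IH cact_neg.
Qed.

Definition npos := count (fun x : int => 0 < x).

Lemma count_pos_swap i (v : seq int) : (i.+1 < size v)%N ->
  npos (cact i v) = npos v.
Proof.
elim: v i => [|x v IH] [|i] //=; last by rewrite ltnS => /IH; rewrite /npos /cact /= -/cact => ->.
by case: v {IH} => [|y v] //= _; rewrite /npos /cact /= addnCA.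
Qed.

Lemma count_pos_cact i (v : seq int) :
  (npos (cact i v) <= (npos v).+1)%N.
Proof.
elim: v i => [|x v IH] [|i] //=; last by have := IH i; rewrite /npos /cact /= -/cact; lia.
by case: v {IH} => [|y v]; rewrite /npos /cact /=; lia.
Qed.

Lemma cactw_const n (j : 'I_n) s v : (forall i, i \in s -> i = j) ->
  cactw (map (@nat_of_ord n) s) v = v \/ cactw (map (@nat_of_ord n) s) v = cact j v.
Proof.
elim: s => [|i s IH] H /=; first by left.
rewrite (H i (mem_head _ _)); case: IH => [k ks|->|->].
- by apply: H; rewrite inE ks orbT.
- by right.
- by rewrite cactK; left.
Qed.

Lemma count_pos_base n : npos (base n) = 0%N.
Proof.
apply/eqP; rewrite /npos -leqn0 leqNgt -has_count; apply/hasPn => x /(allP (base_neg n)).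
by rewrite -leNgt => /ltW.
Qed.

Lemma longest_top n : exists2 t,
  longest (B n) [set: 'I_n] = cword (B n) t &
  cactw (map (@nat_of_ord n) t) (base n) = top n.
Proof.
have [t [rt _ Et Ht]] := longest_word [set: 'I_n]; exists t => //.
rewrite -reducedw_hactw // -eltact_word ?size_base // -[base n]cat0s -[top n]cat0s.
apply: (act_sort_norm Ht); first by rewrite cat0s size_base.
- by move=> i; rewrite inE.
- by rewrite base_top norm_neg ?top_pos.
- exact: top_ge.
Qed.

Lemma act_relative n (J : {set 'I_n}) : exists s,
  [/\ {subset s <= J}, reducedw s, absorbing J (hword (B n) s) &
   eltact (to_hecke (relative_longest (B n) J [set: 'I_n])) (base n) =
   cactw (map (@nat_of_ord n) s) (top n)].
Proof.
have [s [rs sJ Es Hs]] := longest_word J; exists s; split => //.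
have [t Et Ev] := longest_top n.
rewrite /relative_longest Es Et -[X in to_hecke X]wordM act_to_hecke.
by rewrite map_cat cactw_cat Ev.
Qed.

(** Negation commutes with the group action, so the hypothesis gives the value of w_o^J on [base n].
    Its descents bound J, and its p positive entries bound p. *)
Lemma relative_shape n p m q (J : {set 'I_n}) (U V W : seq int) :
    top n = U ++ V ++ W -> size U = m -> size V = p -> size W = q -> (0 < p)%N ->
  eltact (to_hecke (relative_longest (B n) J [set: 'I_n])) (base n) =
    U ++ rev (neg V) ++ W -> p = 1%N /\ q = 0%N.
Proof.
move=> ET sU sV sW p0; have [s [sJ rs Hs ->]] := act_relative J.
move=> /(congr1 neg); rewrite -cactw_neg -base_top !neg_cat => Es.
have EV : neg (rev (neg V)) = rev V.
  by rewrite /neg -map_rev -map_comp -[RHS]map_id; apply: eq_map => x /=; rewrite opprK.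
rewrite EV in Es.
have En : n = (m + p + q)%N by rewrite -(size_top n) ET !size_cat sU sV sW addnA.
have := base_sorted n; rewrite base_top ET !neg_cat catA.
rewrite (sorted_pairwise lt_trans) pairwise_cat => /and3P[_ _ dW].
have := top_pos n; rewrite ET !all_cat => /and3P[U0 V0 W0].
have := top_gt n; rewrite ET !pairwise_cat => /and3P[_ dU /and3P[_ dV _]].
have su : sorted <%R (neg U ++ rev V).
  rewrite (sorted_pairwise lt_trans) pairwise_cat; apply/and3P; split.
  - apply/allrelP => _ y /mapP[x xU ->]; rewrite mem_rev => yV.
    by have := allP U0 _ xU; have := allP V0 _ yV; rewrite /=; clear; lia.
  - by rewrite pairwise_map; apply: sub_pairwise dU => x y /=; lia.
  - by rewrite -(sorted_pairwise lt_trans) rev_sorted; apply: pairwise_sorted dV.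
(* w_o^J descends at every index of J, whereas [neg U ++ rev V] is increasing and [neg W] is
   increasing and negative: only the end of V is left. *)
have sub j : j \in J -> j = (m + p).-1 :> nat.
  move=> jJ; have Ej := (Hs.2 j jJ).1.
  have : hact j (cactw (map (@nat_of_ord n) s) (base n)) =
      cactw (map (@nat_of_ord n) s) (base n).
    rewrite -reducedw_hactw // -eltact_word ?size_base //.
    by apply: absorbing_fix Hs _ jJ; rewrite size_base.
  rewrite Es catA hactE; case: ifP => [aj|naj _].
    by move=> /(congr1 linv); rewrite linv_asc // => /esym/n_Sn.
  have szu : size (neg U ++ rev V) = (m + p)%N by rewrite size_cat size_neg size_rev sU sV.
  have [lt|le] := ltnP j.+1 (m + p)%N.
    by rewrite asc_prefix ?szu in naj.
  have [lt|le'] := ltnP j (m + p)%N; first by clear -lt le; lia.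
  rewrite -(subnKC le') -szu asc_suffix asc_sorted_neg // in naj.
  - by rewrite (sorted_pairwise lt_trans).
  - by rewrite all_map; apply: sub_all W0 => x /=; lia.
  - by rewrite size_neg sW; move: (ltn_ord j) En le' szu; clear; lia.
have cu : npos (cactw (map (@nat_of_ord n) s) (base n)) = p.
  have c0 Y : all (> 0) Y -> npos (neg Y) = 0%N.
    move=> Y0; apply/eqP; rewrite /npos -leqn0 leqNgt -has_count.
    apply/hasPn => _ /mapP[x xY ->].
    by have := allP Y0 x xY; rewrite /=; clear; lia.
  rewrite Es /npos !count_cat -!/(npos _) !c0 // /npos count_rev addn0 add0n.
  by have := V0; rewrite all_count => /eqP ->.
have ltj : ((m + p).-1 < n)%N by move: En p0; clear; lia.
have Hc i : i \in s -> i = Ordinal ltj by move=> /sJ/sub Ei; apply: val_inj.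
(* w_o^J is trivial or this one generator. It makes at most one entry positive, and none if it is an
   exchange, that is if q > 0. *)
case: (cactw_const (base n) Hc) => E; rewrite E in cu.
  by move: p0 cu; rewrite count_pos_base; clear; lia.
have := count_pos_cact (Ordinal ltj) (base n); rewrite cu count_pos_base => lep.
split; first by move: p0 lep; clear; lia.
apply/eqP; rewrite -leqn0 leqNgt; apply/negP => q0.
have ltj' : ((m + p).-1.+1 < size (base n))%N.
  by rewrite size_base; move: p0 q0 En; clear; lia.
by move: cu p0; rewrite (count_pos_swap ltj') count_pos_base => <-.
Qed.

End ParabolicShape.

(** * Homomorphisms defined on generators *)

Section Lift.
Variables (I : finType) (M : coxeterMatrix I) (G : monoidType) (g : I -> G).
Local Open Scope group_scope.

Definition wprod (s : seq I) : G := foldr (fun i x => g i * x) 1 s.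

Lemma wprod_cat s t : wprod (s ++ t) = wprod s * wprod t.
Proof. by elim: s => [|i s IH] /=; rewrite ?mul1g // IH mulgA. Qed.

Lemma hecke_lift : (forall s t, heckeRel M s t -> wprod s = wprod t) ->
  exists phi : UMagmaMorphism.type (Hecke M) G, forall i, phi (hgen M i) = g i.
Proof.
move=> Rg; pose f (x : Hecke M) := wprod (pres_repr x).
have sound u v : pres_eq (heckeRel M) u v -> wprod u = wprod v.
  elim=> {u v} [u v a b /Rg E|u|u v _ ->|u v w _ -> _ ->] //.
  by rewrite !wprod_cat E.
have fE s : f (hword M s) = wprod s.
  by apply: sound; apply/word_eqP; apply: pres_reprK.
have fM : monoid.monoid_morphism f.
  split=> [|x y]; first exact: (fE [::]).
  rewrite -{1}(pres_reprK x) -{1}(pres_reprK y) -wordM -/(hword M _) fE.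
  by rewrite wprod_cat.
pose F := isUMagmaMorphism.Build (Hecke M) G f fM.
pose phi : UMagmaMorphism.type (Hecke M) G := HB.pack f F.
by exists phi => i; rewrite -[LHS]/(f (hword M [:: i])) fE /= mulg1.
Qed.

End Lift.

(** * The eight elements of the Hecke monoid of B_2 *)

Section HeckeB2.
Local Open Scope group_scope.
Local Notation i0 := (ord0 : 'I_2).
Local Notation i1 := (ord_max : 'I_2).
Local Notation hw := (hword (B 2)).

Lemma ord2P (i : 'I_2) : i = i0 \/ i = i1.
Proof. by case: i => [[|[|//]] lti]; [left|right]; apply: val_inj. Qed.

Let g3 i j k : hgen (B 2) i * hgen (B 2) j * hgen (B 2) k = hw [:: i; j; k].
Proof. by rewrite !hword_cons (_ : hw [::] = 1%g) // mulg1 !mulgA. Qed.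

Let g4 i j k l : hgen (B 2) i * hgen (B 2) j * hgen (B 2) k * hgen (B 2) l =
  hw [:: i; j; k; l].
Proof. by rewrite !hword_cons (_ : hw [::] = 1%g) // mulg1 !mulgA. Qed.

Definition words_B2 : seq (seq 'I_2) :=
  [:: [::]; [:: i0]; [:: i1]; [:: i0; i1]; [:: i1; i0]; [:: i0; i1; i0];
      [:: i1; i0; i1]; [:: i0; i1; i0; i1]].

Let act (s : seq 'I_2) := hactw (map (@nat_of_ord 2) s) (base 2).

Lemma words_B2_cover x : exists2 s, s \in words_B2 & x = hw s.
Proof.
rewrite -(pres_reprK x) -/(hw _); elim: (pres_repr x) => [|i t [s sW E]].
  by exists [::].
(* The eight words are closed under left multiplication, as computed on [base 2]. *)
have : all (fun s => all (fun i => has (fun s' => act (i :: s) == act s') words_B2)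
  [:: i0; i1]) words_B2 by vm_compute.
move=> /allP/(_ s sW)/allP/(_ i).
have ii : i \in [:: i0; i1] by rewrite !inE; case: (ord2P i) => ->; rewrite eqxx ?orbT.
move=> /(_ ii)/hasP[s' s'W /eqP E']; exists s' => //.
by rewrite hword_cons E -hword_cons; apply: hword_inj.
Qed.

(* Two distinct elements can be multiplied so that one becomes the absorbing
   element and the other one an element of length 3. *)
Lemma B2_hom_inj (G : magmaType) (f : Hecke (B 2) -> G) :
    {morph f : x y / x * y} ->
    f (s1' * s2' * s1') <> f (s1' * s2' * s1' * s2') ->
    f (s2' * s1' * s2') <> f (s1' * s2' * s1' * s2') -> injective f.
Proof.
move=> fM; rewrite /s1' /s2' !g4 !g3 => h1 h2 x y.
have [u uW ->] := words_B2_cover x; have [v vW ->] := words_B2_cover y => Ef.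
pose z := [:: i0; i1; i0; i1].
pose ok u v := (act u == act z) &&
  ((act v == act [:: i0; i1; i0]) || (act v == act [:: i1; i0; i1])).
have okF s t : ok s t -> f (hw s) <> f (hw t).
  move=> /andP[/eqP/hword_inj ->] /orP[]/eqP/hword_inj ->; exact: nesym.
have : all (fun u => all (fun v => (u == v) || has (fun c => has (fun d =>
  ok (c ++ u ++ d) (c ++ v ++ d) || ok (c ++ v ++ d) (c ++ u ++ d)) words_B2) words_B2)
  words_B2) words_B2 by vm_compute.
move=> /allP/(_ u uW)/allP/(_ v vW)/orP[/eqP -> //|/hasP[c _ /hasP[d _]]].
have E : f (hw (c ++ u ++ d)) = f (hw (c ++ v ++ d)).
  by rewrite /hword !wordM !fM -/(hw u) Ef.
by case/orP=> /okF; rewrite E.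
Qed.

Lemma B2_absorbing : absorbing [set: 'I_2] (s1' * s2' * s1' * s2').
Proof.
rewrite /s1' /s2' g4; split=> [|j _].
  rewrite [LHS]hsupp_hword; apply/setP => i; rewrite !inE.
  by case: (ord2P i) => ->; rewrite ?eqxx ?orbT.
rewrite -hword_cons -[hgen _ _]/(hw [:: j]) -[X in _ /\ X = _]wordM.
by case: (ord2P j) => ->; split; apply: hword_inj; vm_compute.
Qed.

Lemma B2_braid : s1' * s2' * s1' * s2' = s2' * s1' * s2' * s1'.
Proof. by rewrite /s1' /s2' !g4; apply: hword_inj; vm_compute. Qed.

Lemma B2_neq : [/\ s1' <> 1%g, s2' <> 1%g, s1' <> s1' * s2' * s1' * s2',
  s2' <> s1' * s2' * s1' * s2' & (s1' * s2' * s1' <> s1' * s2' * s1' * s2') /\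
  (s2' * s1' * s2' <> s1' * s2' * s1' * s2')].
Proof.
rewrite /s1' /s2' !g4 !g3 -word1.
by split; try split; move=> /word_eqP/(hactw_sound (size_base 2)); vm_compute.
Qed.

(** In the group the letter i cancels against the first letter of the longest word i j i j. *)
Lemma B2_relative i j : i != j ->
  to_hecke (relative_longest (B 2) [set i] [set: 'I_2]) =
  hgen (B 2) j * hgen (B 2) i * hgen (B 2) j.
Proof.
move=> ij.
have EJ : longest (B 2) [set i] = cword (B 2) [:: i].
  apply: longestE; first by case: (ord2P i) => ->; vm_compute.
  split; first by rewrite hsupp_hword; apply/setP => k; rewrite !inE.
  by move=> k /set1P ->; rewrite -hword_cons; split;
    apply: hword_inj; case: (ord2P i) => ->; vm_compute.
have EK : longest (B 2) [set: 'I_2] = cword (B 2) [:: i0; i1; i0; i1].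
  apply: longestE; first by vm_compute.
  by have := B2_absorbing; rewrite /s1' /s2' g4.
rewrite /relative_longest EJ EK -[X in to_hecke X]wordM g3; apply: eltact_inj.
rewrite [LHS]act_to_hecke [RHS]eltact_word ?size_base //.
by move: ij; case: (ord2P i) => ->; case: (ord2P j) => -> //; vm_compute.
Qed.

End HeckeB2.

(** * Homomorphisms from B_2 *)

Section Supports.
Variable n : nat.
Local Open Scope group_scope.

Lemma hsuppM (x y : Hecke (B n)) : hsupp (x * y) = hsupp x :|: hsupp y.
Proof.
rewrite -(pres_reprK x) -(pres_reprK y) -wordM !hsupp_hword.
by apply/setP => i; rewrite !inE mem_cat.
Qed.

Lemma hsupp1 : hsupp (1 : Hecke (B n)) = set0.
Proof. by rewrite -word1 hsupp_hword; apply/setP => i; rewrite !inE. Qed.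

Lemma hsupp0 (x : Hecke (B n)) : hsupp x = set0 -> x = 1.
Proof.
move=> x0; rewrite -(pres_reprK x); case E : (pres_repr x) => [//|i s].
by move/setP: x0 => /(_ i); rewrite mem_hsupp E !inE eqxx.
Qed.

Lemma hgen_idem i : hgen (B n) i * hgen (B n) i = hgen (B n) i.
Proof. by rewrite -[LHS]wordM; apply/word_eqP/pres_eq_rel/HeckeIdem. Qed.

Lemma longest1 i : longest (B n) [set i] = cword (B n) [:: i].
Proof.
apply: longestE.
  rewrite /reducedw /= andbT; apply: asc_sorted_neg; rewrite ?size_base //.
    exact: base_sorted.
  exact: base_neg.
split; first by rewrite hsupp_hword; apply/setP => k; rewrite !inE.
by move=> k /set1P ->; rewrite !hgen_idem.
Qed.

Lemma act_relative1 i :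
  eltact (to_hecke (relative_longest (B n) [set i] [set: 'I_n])) (base n) = cact i (top n).
Proof.
have [t Et Ev] := longest_top n.
by rewrite /relative_longest longest1 Et -cword_cons act_to_hecke /= Ev.
Qed.

End Supports.

Section Homomorphisms.
Variables n' n : nat.
Local Open Scope group_scope.
Implicit Types phi : heckeHom (B n') (B n).

Lemma homM phi x y : phi (x * y) = phi x * phi y.
Proof. exact: gmulfM. Qed.

Lemma hom1 phi : phi 1 = 1.
Proof. exact: gmulf1. Qed.

Lemma hom_gen_absorbing phi i :
  absorbing (hsupp (phi (hgen (B n') i))) (phi (hgen (B n') i)).
Proof. by apply: idem_absorbing; rewrite -homM hgen_idem. Qed.

Lemma hsupp_hom phi x : hsupp (phi x) = hom_supp phi (hsupp x).
Proof.
rewrite -(pres_reprK x) -/(hword (B n') _); elim: (pres_repr x) => [|i s IH].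
  rewrite (_ : hword (B n') [::] = 1) // hom1 !hsupp1 /hom_supp.
  by apply/setP => i; rewrite inE; apply/esym/bigcupP => -[j]; rewrite inE.
have -> : hsupp (phi (hword (B n') (i :: s))) =
    hsupp (phi (hgen (B n') i)) :|: hom_supp phi (hsupp (hword (B n') s)).
  by rewrite hword_cons homM hsuppM; congr (_ :|: _); exact: IH.
rewrite /hom_supp !hsupp_hword; apply/setP => j; apply/setUP/bigcupP.
  case=> [ji|/bigcupP[k ks jk]]; first by exists i => //; rewrite inE mem_head.
  by exists k => //; move: ks; rewrite !inE => ->; rewrite orbT.
case=> k; rewrite !inE => /predU1P[->|ks] jk; first by left.
by right; apply/bigcupP; exists k => //; rewrite inE.
Qed.

(** The image of a generator is idempotent and so absorbs its own support, and x can be written with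
    any generator of K in front or behind. *)
Lemma hom_absorbing phi K x : absorbing K x -> absorbing (hom_supp phi K) (phi x).
Proof.
move=> [sx Hx]; split; first by rewrite hsupp_hom sx.
move=> j /bigcupP[k kK jk]; have [_ /(_ j jk)[L R]] := hom_gen_absorbing phi k.
have [Lx Rx] := Hx k kK; split.
  by rewrite -Lx homM mulgA L.
by rewrite -Rx homM -mulgA R.
Qed.

Lemma hom_hlongest phi K : phi (hlongest K) = hlongest (hom_supp phi K).
Proof.
exact: absorbing_unique (hom_absorbing phi (hlongest_absorbing K)) (hlongest_absorbing _).
Qed.

End Homomorphisms.

(** * Connected subsets are intervals *)

Section Intervals.
Variable n : nat.
Implicit Types J : {set 'I_n}.

Lemma coxeter_adjE (i j : 'I_n) :
  coxeter_adj (B n) i j = (i.+1 == j :> nat) || (j.+1 == i :> nat).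
Proof.
rewrite /coxeter_adj B_weightE /B_weight; case: (eqVneq (i : nat) j) => [->|_] /=.
  by lia.
by case: ifP => //; case: ifP.
Qed.

(** If j were missing from J, no edge inside J could pass from below j to above it. *)
Lemma connected_convex J (i j k : 'I_n) : connected_subset (B n) J ->
  i \in J -> k \in J -> i <= j <= k -> j \in J.
Proof.
move=> cJ iJ kJ /andP[le_ij le_jk]; apply/negP => /negP jJ.
set e := [rel x y | [&& x \in J, y \in J & coxeter_adj (B n) x y]] : rel 'I_n.
have cl : closed e [pred x : 'I_n | x < j].
  move=> x y /and3P[xJ yJ]; rewrite coxeter_adjE !inE => adj.
  have xj : x != j :> nat by apply: contraNneq jJ => /val_inj <-.
  have yj : y != j :> nat by apply: contraNneq jJ => /val_inj <-.
  lia.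
have := closed_connect cl (cJ i k iJ kJ); rewrite !inE.
have ij : i != j :> nat by apply: contraNneq jJ => /val_inj <-.
lia.
Qed.

Lemma connected_interval J : connected_subset (B n) J -> J != set0 ->
  exists u v : 'I_n, [/\ u \in J, v \in J & forall i : 'I_n, (i \in J) = (u <= i <= v)].
Proof.
move=> cJ /set0Pn[i0 i0J].
case: (@arg_minnP _ i0 (mem J) (@nat_of_ord n) i0J) => u uJ minu.
case: (@arg_maxnP _ i0 (mem J) (@nat_of_ord n) i0J) => v vJ maxv.
exists u, v; split => // i; apply/idP/idP => [iJ|]; last exact: connected_convex cJ uJ vJ.
by apply/andP; split; [apply: minu|apply: maxv].
Qed.

Lemma interval_connected J u v : (forall i : 'I_n, (i \in J) = (u <= i <= v)) ->
  connected_subset (B n) J.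
Proof.
move=> EJ; pose e := [rel x y | [&& x \in J, y \in J & coxeter_adj (B n) x y]] : rel 'I_n.
have se : connect_sym e.
  by apply: sym_connect_sym => x y; rewrite /e /= !coxeter_adjE orbC andbCA.
suff H k : forall i j : 'I_n, i \in J -> j \in J -> j = i + k :> nat -> connect e i j.
  move=> i j iJ jJ; have [le_ij|/ltnW le_ji] := leqP i j.
    by apply: (H (j - i)) => //; lia.
  by rewrite se; apply: (H (i - j)) => //; lia.
elim: k => [|k IH] i j iJ jJ Ej.
  by rewrite (_ : j = i) //; apply: val_inj; rewrite /= Ej addn0.
have lti : i.+1 < n by have := ltn_ord j; lia.
pose i' := Ordinal lti; have i'J : i' \in J.
  by move: iJ jJ; rewrite !EJ /=; lia.
apply: (connect_trans (y := i')).
  by apply: connect1; rewrite /e /= iJ i'J coxeter_adjE eqxx.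
by apply: IH => //=; lia.
Qed.

End Intervals.

(** * Classification *)

Section Classification.
Variable n : nat.
Local Open Scope group_scope.

Lemma ordered_case (a b z : Hecke (B n)) (J K Z : {set 'I_n}) (u j k v : nat) :
    absorbing J a -> absorbing K b -> absorbing Z z ->
    (forall i : 'I_n, (i \in J) = (u <= i <= j)%N) ->
    (forall i : 'I_n, (i \in K) = (k <= i <= v)%N) ->
    (forall i : 'I_n, (i \in Z) = (u <= i <= v)%N) ->
    (u < k)%N -> (k <= j.+1)%N -> (j < v)%N -> (v < n)%N -> (u <= j)%N ->
    a * b * a * b = z -> b * a * b * a = z -> a * b * a <> z -> b * a * b <> z ->
  (v = n.-1 /\ k - u <= j.+2 - k)%N.
Proof.
move=> Ha Hb Hz EJ EK EZ uk kj jv vn uj abab baba aba bab.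
(* The generator i moves the entries i and i + 1, so J sorts the entries u, ..., j + 1, of which k,
   ..., j + 1 are shared with K. *)
pose p := (k - u)%N; pose m := (j.+2 - k)%N.
have EJ' (i : 'I_n) : (i \in J) = (u <= i)%N && (i.+1 < u + p + m)%N.
  by rewrite EJ /p /m; lia.
have [vn1|vn1] := ltnP v.+1 n.
  pose q := (v - j)%N; pose t := (n - v.+2)%N.
  have En : n = (u + p + m + q + t)%N by rewrite /p /m /q /t; lia.
  have EK' (i : 'I_n) : (i \in K) = (u + p <= i)%N && (i.+1 < u + p + m + q)%N.
    by rewrite EK /p /m /q; lia.
  have EZ' (i : 'I_n) : (i \in Z) = (u <= i)%N && (i.+1 < u + p + m + q)%N.
    by rewrite EZ /p /m /q; lia.
  have [qm|mq] := leqP q m.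
    by case: aba; apply: (typeA_aba Ha Hb Hz En EJ' EK' EZ').
  have [pm|mp] := leqP p m.
    by case: bab; apply: (typeA_bab Ha Hb Hz En EJ' EK' EZ').
  by case: (typeA_obstruction Ha Hb Hz En EJ' EK' EZ' mp mq).
split; first lia.
have [//|mp] := leqP p m.
have En : n = (u + p + m + (n - j.+2))%N by rewrite /p /m; lia.
case: (typeB_obstruction Ha Hb Hz En EJ' _ _ mp) => //.
- by move=> i; rewrite EK /p; have := ltn_ord i; lia.
- by move=> i; rewrite EZ; have := ltn_ord i; lia.
Qed.

Lemma itvE a b (i : 'I_n) : (i \in itv n a b) = (a <= i.+1 <= b)%N.
Proof. by rewrite inE. Qed.

Lemma w0_absorbing a b : absorbing (itv n a b) (w0 n a b).
Proof. exact: hlongest_absorbing. Qed.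

Lemma hom_supp1 (phi : heckeHom (B 2) (B n)) i :
  hom_supp phi [set i] = hsupp (phi (hgen (B 2) i)).
Proof. by rewrite /hom_supp big_set1. Qed.

Lemma hom_suppT (phi : heckeHom (B 2) (B n)) :
  hom_supp phi [set: 'I_2] = hsupp (phi s1') :|: hsupp (phi s2').
Proof.
apply/setP => j; apply/bigcupP/setUP => [[i _]|].
  by case: (ord2P i) => ->; [left|right].
by case=> H; [exists ord0|exists ord_max].
Qed.

Lemma connected1 (i : 'I_2) : connected_subset (B 2) [set i].
Proof. by move=> x y /set1P -> /set1P ->; apply: connect0. Qed.

Lemma connectedT2 : connected_subset (B 2) [set: 'I_2].
Proof. by apply: (@interval_connected _ _ 0 1) => i; rewrite inE; have := ltn_ord i; lia. Qed.

Lemma classification (phi : heckeHom (B 2) (B n)) :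
    injective phi -> connected_hom phi ->
    exists p l k : nat,
       [/\ p + 2 <= n, 2 <= l <= uphalf (n - p).+1,
           2 * l - 3 <= k <= n - p - 1
         & exists2 psi : Hecke (B 2) -> Hecke (B n),
             psi = phi \/ psi = phi \o diag_aut
           & psi s1' = w0 n (p + 1) (p + k) /\ psi s2' = w0 n (p + l) n]%N.
Proof.
move=> injphi cphi; set a := phi s1'; set b := phi s2'.
have Ha : absorbing (hsupp a) a := hom_gen_absorbing phi ord0.
have Hb : absorbing (hsupp b) b := hom_gen_absorbing phi ord_max.
set z := phi (s1' * s2' * s1' * s2').
have Hz : absorbing (hsupp a :|: hsupp b) z.
  by rewrite -hom_suppT; apply/hom_absorbing/B2_absorbing.
have abab : a * b * a * b = z by rewrite /a /b /z !homM.
have baba : b * a * b * a = z by rewrite /a /b /z B2_braid !homM.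
have [a1 b1 az bz [aba bab]] := B2_neq.
have {}aba : a * b * a <> z by rewrite /a /b /z -!homM => /injphi.
have {}bab : b * a * b <> z by rewrite /a /b /z -!homM => /injphi.
have {}a1 : hsupp a != set0.
  by apply/eqP => /hsupp0; rewrite /a -(hom1 phi) => /injphi.
have {}b1 : hsupp b != set0.
  by apply/eqP => /hsupp0; rewrite /b -(hom1 phi) => /injphi.
have {}az : a <> z by move=> /injphi.
have {}bz : b <> z by move=> /injphi.
have ca : connected_subset (B n) (hsupp a).
  by rewrite -[hsupp a]hom_supp1; apply/cphi/connected1.
have cb : connected_subset (B n) (hsupp b).
  by rewrite -[hsupp b]hom_supp1; apply/cphi/connected1.
have cz : connected_subset (B n) (hsupp a :|: hsupp b).
  by rewrite -hom_suppT; apply/cphi/connectedT2.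
have core (x y : Hecke (B n)) (u j k v : 'I_n) :
    absorbing (hsupp x) x -> absorbing (hsupp y) y -> absorbing (hsupp x :|: hsupp y) z ->
    connected_subset (B n) (hsupp x :|: hsupp y) ->
    x <> z -> y <> z -> 
    x * y * x * y = z -> y * x * y * x = z -> x * y * x <> z -> y * x * y <> z ->
    u \in hsupp x -> j \in hsupp x -> k \in hsupp y -> v \in hsupp y ->
    (forall i : 'I_n, (i \in hsupp x) = (u <= i <= j)%N) ->
    (forall i : 'I_n, (i \in hsupp y) = (k <= i <= v)%N) -> (u <= k)%N ->
  exists p l k : nat,
       [/\ p + 2 <= n, 2 <= l <= uphalf (n - p).+1,
           2 * l - 3 <= k <= n - p - 1
         & x = w0 n (p + 1) (p + k) /\ y = w0 n (p + l) n]%N.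
  move=> Hx Hy Hxy cxy xz yz xyxy yxyx xyx yxy ux jx ky vy Ex Ey le_uk.
  (* Nested supports are impossible: the factor with the larger one would be absorbing for the
     union, hence equal to z. *)
  have lt_jv : (j < v)%N.
    rewrite ltnNge; apply/negP => le_vj; apply: xz; apply: absorbing_unique Hx _.
    rewrite (_ : hsupp x = hsupp x :|: hsupp y) //; apply/esym/setUidPl/subsetP => i.
    by rewrite Ex Ey; lia.
  have lt_uk : (u < k)%N.
    rewrite ltnNge; apply/negP => le_ku; apply: yz; apply: absorbing_unique Hy _.
    rewrite (_ : hsupp y = hsupp x :|: hsupp y) //; apply/esym/setUidPr/subsetP => i.
    by rewrite Ex Ey; lia.
  have le_uj : (u <= j)%N by have := ux; rewrite Ex => /andP[].
  have le_kv : (k <= v)%N by have := vy; rewrite Ey => /andP[].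
  (* A gap between the two intervals would disconnect their union. *)
  have le_kj : (k <= j.+1)%N.
    rewrite leqNgt; apply/negP => lt_jk.
    have ltj : (j.+1 < n)%N by have := ltn_ord k; lia.
    have : Ordinal ltj \in hsupp x :|: hsupp y.
      apply: (connected_convex (i := j) (k := k)) cxy _ _ _.
      - by rewrite in_setU jx.
      - by rewrite in_setU ky orbT.
      - by rewrite /= leqnSn ltnW.
    by rewrite in_setU Ex Ey /=; lia.
  have Ez (i : 'I_n) : (i \in hsupp x :|: hsupp y) = (u <= i <= v)%N.
    by rewrite in_setU Ex Ey; lia.
  have [Ev le_pm] := ordered_case Hx Hy Hxy Ex Ey Ez lt_uk le_kj lt_jv (ltn_ord v) le_uj
    xyxy yxyx xyx yxy.
  have ltvn := ltn_ord v.
  (* The shift is [u]; relative to it and counted from 1, the second interval starts at k - u + 1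
     and the first ends at j + 1 - u. Then [le_pm] is the bound 2l - 3 <= k. *)
  exists u, (k - u).+1, (j.+1 - u)%N; split.
  - lia.
  - apply/andP; split; first lia.
    by rewrite /= ltnS geq_half_double; lia.
  - lia.
  split.
    apply: absorbing_unique Hx _; rewrite (_ : hsupp x = itv n (u + 1) (u + (j.+1 - u))).
      exact: w0_absorbing.
    by apply/setP => i; rewrite itvE Ex; lia.
  apply: absorbing_unique Hy _; rewrite (_ : hsupp y = itv n (u + (k - u).+1) n).
    exact: w0_absorbing.
  by apply/setP => i; rewrite itvE Ey; have := ltn_ord i; lia.
have [u [j [ua ja Ea]]] := connected_interval ca a1.
have [k [v [kb vb Eb]]] := connected_interval cb b1.
have [le_uk|/ltnW le_ku] := leqP u k.
  have [p [l [k' [h1 h2 h3 [ea eb]]]]] := core _ _ _ _ _ _ Ha Hb Hz cz az bz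
    abab baba aba bab ua ja kb vb Ea Eb le_uk.
  by exists p, l, k'; split=> //; exists phi; [left|].
(* If b has the interval starting first, the diagram automorphism exchanges the roles. *)
rewrite setUC in Hz cz.
have [p [l [k' [h1 h2 h3 [eb ea]]]]] := core _ _ _ _ _ _ Hb Ha Hz cz bz az
  baba abab bab aba kb vb ua ja Eb Ea le_ku.
exists p, l, k'; split=> //; exists (phi \o diag_aut); first by right.
by rewrite /= diag_aut_s1' diag_aut_s2'.
Qed.

End Classification.

(** * Existence, injectivity and parabolicity *)

Section Existence.
Variables (n l k : nat).
Hypothesis hn : 2 <= n.
Hypothesis hl : 2 <= l <= uphalf n.+1.
Hypothesis hk : 2 * l - 3 <= k <= n - 1.
Local Open Scope group_scope.

Local Notation a := (w0 n 1 k).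
Local Notation b := (w0 n l n).
(** [1, k] sorts k + 1 entries, and [l, n] leaves the first l - 1 entries alone; so k + 2 - l
    entries are common. *)
Let p := l.-1.
Let m := (k + 2 - l)%N.
Let q := (n - k.+1)%N.

Let En : n = (p + m + q)%N.
Proof. by rewrite /p /m /q; lia. Qed.

Let p0 : (0 < p)%N.
Proof. by rewrite /p; lia. Qed.

Let le_pm : (p <= m)%N.
Proof. by rewrite /p /m; lia. Qed.

Let Ha : absorbing (itv n 1 k) a := w0_absorbing n 1 k.
Let Hb : absorbing (itv n l n) b := w0_absorbing n l n.

Let EJ (i : 'I_n) : (i \in itv n 1 k) = (i.+1 < p + m)%N.
Proof. by rewrite itvE /p /m; lia. Qed.

Let EK (i : 'I_n) : (i \in itv n l n) = (p <= i)%N.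
Proof. by rewrite itvE /p; have := ltn_ord i; lia. Qed.

Lemma w0_hom : exists phi : heckeHom (B 2) (B n), phi s1' = a /\ phi s2' = b.
Proof.
pose g (i : 'I_2) := if i == ord0 then a else b.
have [s t|phi Ephi] := @hecke_lift _ (B 2) (Hecke (B n)) g.
  case=> [i|i j ij _].
    rewrite /= mulg1 /g.
    by case: ifP => _; [exact: absorbing_idem Ha|exact: absorbing_idem Hb].
  have E := hom_relation En Ha Hb EJ EK le_pm.
  have E4 : B 2 i j = 4%N.
    by rewrite B_weightE; case: (ord2P i) ij => ->; case: (ord2P j) => ->.
  rewrite E4 /= !mulg1 !mulgA /g.
  by case: (ord2P i) ij => ->; case: (ord2P j) => -> //= _; rewrite E.
exists phi; rewrite -[phi s1']/(phi (hgen (B 2) ord0)).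
by rewrite -[phi s2']/(phi (hgen (B 2) ord_max)) !Ephi.
Qed.

Variable phi : heckeHom (B 2) (B n).
Hypothesis phi1 : phi s1' = a.
Hypothesis phi2 : phi s2' = b.

Lemma w0_hom_inj : injective phi.
Proof.
apply: B2_hom_inj; first exact: homM.
  by rewrite !homM phi1 phi2; apply: (aba_neq En Ha Hb EJ EK).
by rewrite !homM phi1 phi2; apply: (bab_neq En Ha Hb EJ EK).
Qed.

Lemma w0_hom_supp : hom_supp phi [set: 'I_2] = [set: 'I_n].
Proof.
rewrite hom_suppT phi1 phi2; have [-> _] := Ha; have [-> _] := Hb.
by apply/setP => i; rewrite !inE /=; have := ltn_ord i; lia.
Qed.

Lemma set_I2 (K : {set 'I_2}) :
  [\/ K = set0, K = [set ord0], K = [set ord_max] | K = [set: 'I_2]].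
Proof.
case h0 : (ord0 \in K); case h1 : (ord_max \in K);
  [apply: Or44|apply: Or42|apply: Or43|apply: Or41];
  by apply/setP => i; rewrite !inE; case: (ord2P i) => ->; rewrite ?h0 ?h1.
Qed.

Lemma w0_hom_connected : connected_hom phi.
Proof.
move=> K _; case: (set_I2 K) => ->.
- by move=> i j /bigcupP[u]; rewrite inE.
- rewrite hom_supp1 -[phi _]/(phi s1') phi1; have [-> _] := Ha.
  by apply: (@interval_connected _ _ 0 k.-1) => i; rewrite itvE; lia.
- rewrite hom_supp1 -[phi _]/(phi s2') phi2; have [-> _] := Hb.
  apply: (@interval_connected _ _ l.-1 n.-1) => i; rewrite itvE.
  by have := ltn_ord i; lia.
- rewrite w0_hom_supp; apply: (@interval_connected _ _ 0 n.-1) => i; rewrite inE.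
  by have := ltn_ord i; lia.
Qed.

Let phi_relative i j : i != j ->
  phi (to_hecke (relative_longest (B 2) [set i] [set: 'I_2])) =
  phi (hgen (B 2) j) * phi (hgen (B 2) i) * phi (hgen (B 2) j).
Proof. by move=> ij; rewrite (B2_relative ij) !homM. Qed.

Lemma w0_hom_parabolic : parabolic_hom phi <-> k = (n - 1)%N /\ l = 2.
Proof.
split=> [par|[Ek El]].
  (* This single relative longest element, with image aba, already decides the matter. *)
  have [_ [J _]] := par [set: 'I_2] [set ord_max] (finite_parab _) (subsetT _).
  rewrite (phi_relative (j := ord0)) // -[hgen _ ord0]/s1' -[hgen _ ord_max]/s2'.
  rewrite phi1 phi2 w0_hom_supp => /(congr1 (fun x => eltact x (base n))).
  have [U [V [W [ET sU sV sW]]]] : exists U V W,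
    [/\ top n = U ++ V ++ W, size U = m, size V = p & size W = q].
    by apply: top_split; rewrite {1}En; lia.
  rewrite !eltactM ?size_eltact ?size_base // (aba_value En Ha Hb EJ EK ET) // => /esym E.
  by have [] := relative_shape ET sU sV sW p0 E; rewrite /p /q; lia.
have one : to_hecke (1 : Cox (B n)) = 1.
  by rewrite -[1]/(cword (B n) [::]) to_hecke_reduced.
have one2 : to_hecke (1 : Cox (B 2)) = 1.
  by rewrite -[1]/(cword (B 2) [::]) to_hecke_reduced.
have longest0 n' : longest (B n') set0 = 1.
  by have [[|i s] [_ sJ -> _]] := longest_word (set0 : {set 'I_n'});
    last by have := sJ i (mem_head _ _); rewrite inE.
have p1 : p = 1%N by rewrite /p El.
have q0 : q = 0%N by rewrite /q Ek; lia.
have Em : n = (1 + m)%N by rewrite {1}En p1 q0 addn0.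
move=> K J _ sJK; split; first exact: finite_parab.
have [->|nJK] := eqVneq J K.
  (* Both relative longest elements are trivial, as longest elements are involutions. *)
  exists (hom_supp phi K) => //.
  by rewrite /relative_longest !longest_invol one2 one hom1.
have [->|nJ0] := eqVneq J set0.
  exists set0; first exact: sub0set.
  by rewrite /relative_longest !longest0 !mul1g -!/(hlongest _) hom_hlongest.
have EK' : K = [set: 'I_2].
  case: (set_I2 K) nJK sJK => -> //.
  - by rewrite subset0 => _ /eqP E; rewrite E eqxx in nJ0.
  - by rewrite subset1 (negbTE nJ0) orbF => /negbTE ->.
  - by rewrite subset1 (negbTE nJ0) orbF => /negbTE ->.
rewrite EK' w0_hom_supp in nJK *.
case: (set_I2 J) nJ0 nJK => ->; rewrite ?eqxx // => _ _.
  rewrite (phi_relative (j := ord_max)) // -[hgen _ ord0]/s1' -[hgen _ ord_max]/s2'.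
  rewrite phi1 phi2.
  have lt0 : (0 < n)%N by lia.
  (* For p = 1 and q = 0 the value of bab is [top n] with its first two entries exchanged. *)
  exists [set Ordinal lt0]; first exact: subsetT.
  have [U [V [W [ET sU sV sW]]]] : exists U V W,
    [/\ top n = U ++ V ++ W, size U = 1%N, size V = 1%N & size W = (m.-1)%N].
    by apply: top_split; rewrite {1}Em; lia.
  apply: eltact_inj; rewrite act_relative1 !eltactM ?size_eltact ?size_base //.
  have ET' : top n = U ++ (V ++ W) ++ [::] by rewrite cats0.
  rewrite (bab_value En Ha Hb EJ EK ET') ?p1 ?q0 ?size_cat ?sV ?sW //; last by lia.
  rewrite cats0 ET; case: U sU {ET ET'} => [|x [|? ?]] // _.
  by case: V sV => [|y [|? ?]].
rewrite (phi_relative (j := ord0)) // -[hgen _ ord0]/s1' -[hgen _ ord_max]/s2'.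
rewrite phi1 phi2.
have ltm : (m < n)%N by lia.
(* For p = 1 and q = 0 the value of aba is [top n] with the sign of its last entry changed, and m =
   n - 1 is the last index counted from 0. *)
exists [set Ordinal ltm]; first exact: subsetT.
have [U [V [W [ET sU sV sW]]]] : exists U V W,
  [/\ top n = U ++ V ++ W, size U = m, size V = 1%N & size W = 0%N].
  by apply: top_split; rewrite {1}Em; lia.
apply: eltact_inj; rewrite act_relative1 !eltactM ?size_eltact ?size_base //.
rewrite (aba_value En Ha Hb EJ EK ET) ?p1 ?q0 // ET /=.
case: W sW {ET} => // _; rewrite !cats0 -sU.
case: V sV => [|x [|? ?]] // _; rewrite /neg /=.
by elim: U {sU} => //= y U ->.
Qed.

End Existence.

Lemma connected_homP n (phi : heckeHom (B 2) (B n)) :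
  connected_hom phi <->
  [/\ connected_subset (B n) (hsupp (phi s1')), connected_subset (B n) (hsupp (phi s2'))
    & connected_subset (B n) (hsupp (phi s1') :|: hsupp (phi s2'))].
Proof.
rewrite -hom_suppT -[hsupp (phi s1')]hom_supp1 -[hsupp (phi s2')]hom_supp1.
split=> [cphi|[c1 c2 c12] K _].
  by split; apply: cphi; [exact: connected1|exact: connected1|exact: connectedT2].
case: (set_I2 K) => -> //.
by move=> i j /bigcupP[u]; rewrite inE.
Qed.

(** * Twisting by the diagram automorphism *)

Section DiagramTwist.
Variables (n : nat) (phi : heckeHom (B 2) (B n)).

(** Provides the composite as a homomorphism, so that the results on homomorphisms apply to it. *)
Lemma diag_twist : exists chi : heckeHom (B 2) (B n), forall x, chi x = phi (diag_aut x).
Proof. by exists (phi \o diag_aut : heckeHom (B 2) (B n)). Qed.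

Lemma diag_twist_transfer (chi : heckeHom (B 2) (B n)) :
    (forall x, chi x = phi (diag_aut x)) ->
    [/\ injective chi, connected_hom chi & hom_supp chi [set: 'I_2] = [set: 'I_n]] ->
  [/\ injective phi, connected_hom phi & hom_supp phi [set: 'I_2] = [set: 'I_n]].
Proof.
move=> E [ichi /connected_homP[c1 c2 c12] sT].
have E1 : chi s1' = phi s2' by rewrite E diag_aut_s1'.
have E2 : chi s2' = phi s1' by rewrite E diag_aut_s2'.
rewrite hom_suppT E1 E2 in sT; rewrite E1 E2 in c1 c2 c12.
split; last by rewrite hom_suppT setUC.
  move=> x y; rewrite -(diag_autK x) -(diag_autK y) -!E => /ichi ->.
  by [].
by apply/connected_homP; rewrite setUC.
Qed.

End DiagramTwist.

Theorem proposition5p7 (n : nat) (hn : 2 <= n) :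
  (forall l k : nat,
     2 <= l <= uphalf n.+1 -> 2 * l - 3 <= k <= n - 1 ->
     exists phi : heckeHom (B 2) (B n),
       [/\ phi s1' = w0 n 1 k,
           phi s2' = w0 n l n,
           injective phi
         & parabolic_hom phi <-> k = n - 1 /\ l = 2])
  /\
  (forall phi : heckeHom (B 2) (B n),
     [/\ injective phi, connected_hom phi & hom_supp phi [set: 'I_2] = [set: 'I_n]]
     <->
     exists l k : nat,
       [/\ 2 <= l <= uphalf n.+1, 2 * l - 3 <= k <= n - 1
         & exists2 psi : Hecke (B 2) -> Hecke (B n),
             psi = phi \/ psi = phi \o diag_aut
           & psi s1' = w0 n 1 k /\ psi s2' = w0 n l n])
  /\
  (forall phi : heckeHom (B 2) (B n),
     injective phi -> connected_hom phi ->
     exists p l k : nat,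
       [/\ p + 2 <= n, 2 <= l <= uphalf (n - p).+1,
           2 * l - 3 <= k <= n - p - 1
         & exists2 psi : Hecke (B 2) -> Hecke (B n),
             psi = phi \/ psi = phi \o diag_aut
           & psi s1' = w0 n (p + 1) (p + k) /\ psi s2' = w0 n (p + l) n]).
Proof.
split; [|split].
- move=> l k hl hk; have [phi [e1 e2]] := w0_hom hn hl hk.
  exists phi; split => //; first exact: (@w0_hom_inj n l k hn hl hk phi e1 e2).
  exact: (@w0_hom_parabolic n l k hn hl hk phi e1 e2).
- move=> phi; split=> [[iphi cphi sphi]|[l [k [hl hk [psi Epsi [e1 e2]]]]]].
    have [p [l [k [hp hl hk [psi Epsi [e1 e2]]]]]] := classification iphi cphi.
    have lt0 : 0 < n by lia.
    (* Full support contains the first index, which a positive shift would exclude from both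
       intervals. *)
    have p0 : p = 0.
      have : Ordinal lt0 \in hsupp (psi s1') :|: hsupp (psi s2').
        case: Epsi => ->; last by rewrite /= diag_aut_s1' diag_aut_s2' setUC -hom_suppT sphi inE.
        by rewrite -hom_suppT sphi inE.
      rewrite e1 e2 in_setU; have [-> _] := w0_absorbing n (p + 1) (p + k).
      have [-> _] := w0_absorbing n (p + l) n.
      by rewrite !itvE /=; lia.
    rewrite p0 subn0 in hl hk e1 e2.
    by exists l, k; split=> //; exists psi.
  have full (chi : heckeHom (B 2) (B n)) : chi s1' = w0 n 1 k -> chi s2' = w0 n l n ->
      [/\ injective chi, connected_hom chi & hom_supp chi [set: 'I_2] = [set: 'I_n]].
    move=> c1 c2; split.
    - exact: (@w0_hom_inj n l k hn hl hk chi c1 c2).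
    - exact: (@w0_hom_connected n l k hn hl hk chi c1 c2).
    - exact: (@w0_hom_supp n l k hn hl hk chi c1 c2).
  case: Epsi => Epsi; rewrite Epsi in e1 e2; first exact: full.
  have [chi Echi] := diag_twist phi.
  by apply: (diag_twist_transfer Echi); apply: full; rewrite Echi.
- exact: classification.
Qed.
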